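(* Let $\mathcal{C}$ be a modular category of rank $5$ with simple objects $\mathbf{1}=X_0,X_1,X_2,X_3,X_4$ (up to isomorphism) satisfying $\dim(X_i)>0$ for all $i$. Suppose that $X_3\cong X_4^*$, that $X_1$ and $X_2$ are self-dual, and that $\mathrm{Gal}(\mathcal{C})=\langle (0\;1\;2),(3\;4)\rangle$ as a subgroup of the symmetric group on $\{0,1,2,3,4\}$. Then the Grothendieck ring $Gr(\mathcal{C})$ is isomorphic, as a based ring, to $Gr(SU(3)_4/\mathbb{Z}_3)$, the based ring with basis $Y_0=1,Y_1,Y_2,Y_3,Y_4$ and product $Y_iY_j=\sum_k (N_i)_{k,j}Y_k$, where $N_0$ is the identity matrix, $$N_1=\begin{pmatrix}0&1&0&0&0\\1&2&1&1&1\\0&1&1&1&1\\0&1&1&1&0\\0&1&1&0&1\end{pmatrix},\quad N_2=\begin{pmatrix}0&0&1&0&0\\0&1&1&1&1\\1&1&1&0&0\\0&1&0&0&1\\0&1&0&1&0\end{pmatrix},\quad N_3=\begin{pmatrix}0&0&0&0&1\\0&1&1&0&1\\0&1&0&1&0\\1&1&0&0&0\\0&0&1&1&0\end{pmatrix},$$ and $N_4=N_3^{T}$ (rows and columns indexed by $0,\ldots,4$).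
   Context: A modular category is a finite semisimple $\mathbb{C}$-linear rigid braided balanced (ribbon) monoidal category with simple unit object $\mathbf{1}$ whose $S$-matrix is invertible. Its rank is the number $n$ of isomorphism classes of simple objects, with representatives $\mathbf{1}=X_0,X_1,\ldots,X_{n-1}$. $\dim(X)$ denotes the categorical (quantum) dimension with respect to the ribbon structure. The $S$-matrix is $\tilde S=(\tilde s_{ij})$, where $\theta_i\theta_j\tilde s_{ij}=\sum_k N_{i^*,j}^k\dim(X_k)\theta_k$, $\theta_i$ is the twist of $X_i$, $X_{i^*}=X_i^*$ is the dual of $X_i$, and $N_{i,j}^k=\dim\mathrm{Hom}(X_i\otimes X_j,X_k)$. The Grothendieck ring $Gr(\mathcal{C})$ is the based ring with basis the isomorphism classes of simple objects and product $X_iX_j=\sum_k N_{i,j}^kX_k$; an isomorphism of based rings is a ring isomorphism carrying distinguished basis to distinguished basis. Let $\psi_i$ be the character of $Gr(\mathcal{C})$ given by $\psi_i(X_j)=\tilde s_{ij}/\dim(X_i)$. Let $K=\mathbb{Q}(\tilde s_{ij})$ and $\mathrm{Gal}(\mathcal{C})=\mathrm{Gal}(K/\mathbb{Q})$. The action of $\mathrm{Gal}(\mathcal{C})$ on $K$ permutes the characters $\psi_0,\ldots,\psi_{n-1}$, giving an injective group homomorphism $\mathrm{Gal}(\mathcal{C})\to S_n$ (permutations of the labels $0,\ldots,n-1$), through which $\mathrm{Gal}(\mathcal{C})$ is identified with a subgroup of $S_n$. $SU(3)_4/\mathbb{Z}_3$ denotes the known rank $5$ modular category with the fusion rules displayed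 in the claim. *)

(* Defs.v *)
From HB Require Import structures.
From mathcomp Require Import all_boot all_order all_algebra all_fingroup.
From mathcomp Require Import boolp classical_sets functions reals.
From mathcomp Require Import complex.

Set Implicit Arguments.
Unset Strict Implicit.
Unset Printing Implicit Defensive.

Import Order.TTheory GRing.Theory Num.Theory.
Local Open Scope classical_set_scope.
Local Open Scope ring_scope.

Record linear_category (K : fieldType) := LinearCategory {
  obj :> Type;
  hom : obj -> obj -> vectType K;
  idm : forall A, hom A A;
  comp : forall A B D, hom B D -> hom A B -> hom A D;
  comp_idl : forall A B (f : hom A B), comp (idm B) f = f;
  comp_idr : forall A B (f : hom A B), comp f (idm A) = f;
  comp_assoc : forall A B D E (h : hom D E) (g : hom B D) (f : hom A B),
    comp h (comp g f) = comp (comp h g) f;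
  comp_linl : forall A B D a (g g' : hom B D) (f : hom A B),
    comp (a *: g + g') f = a *: comp g f + comp g' f;
  comp_linr : forall A B D a (g : hom B D) (f f' : hom A B),
    comp g (a *: f + f') = a *: comp g f + comp g f'
}.

Arguments hom {K l} A B.
Arguments idm {K l} A.
Arguments comp {K l A B D} g f.

Declare Scope mor_scope.
Delimit Scope mor_scope with mor.
Notation "g ∘ f" := (comp g f) (at level 40, left associativity) : mor_scope.
Local Open Scope mor_scope.

Section AbelianSemisimple.
Context {K : fieldType} {C : linear_category K}.
Implicit Types A B D X Y Z : C.

Definition is_iso A B (f : hom A B) : Prop :=
  exists g : hom B A, g ∘ f = idm A /\ f ∘ g = idm B.

Definition isomorphic A B : Prop := exists f : hom A B, is_iso f.

Definition is_mono A B (f : hom A B) : Prop :=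
  forall Z (g h : hom Z A), f ∘ g = f ∘ h -> g = h.

Definition is_epi A B (f : hom A B) : Prop :=
  forall Z (g h : hom B Z), g ∘ f = h ∘ f -> g = h.

Definition is_kernel A B (f : hom A B) D (k : hom D A) : Prop :=
  f ∘ k = 0 /\
  forall Z (g : hom Z A), f ∘ g = 0 -> exists! h : hom Z D, k ∘ h = g.

Definition is_cokernel A B (f : hom A B) D (q : hom B D) : Prop :=
  q ∘ f = 0 /\
  forall Z (g : hom B Z), g ∘ f = 0 -> exists! h : hom D Z, h ∘ q = g.

(* For m = 0 this says that X is a zero object. *)
Definition is_direct_sum m (Y : 'I_m -> C) X : Prop :=
  exists (i : forall a, hom (Y a) X) (p : forall a, hom X (Y a)),
    [/\ forall a, p a ∘ i a = idm (Y a),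
        forall a b, a != b -> p a ∘ i b = 0 &
        \sum_a (i a ∘ p a) = idm X].

Definition simple_object X : Prop :=
  idm X != 0 /\
  forall Y (f : hom Y X), is_mono f -> f = 0 \/ is_iso f.

End AbelianSemisimple.

Record abelian_category (K : fieldType) (C : linear_category K) : Prop :=
  AbelianCategory {
  direct_sums : forall m (Y : 'I_m -> C), exists X, is_direct_sum Y X;
  kernels : forall (A B : C) (f : hom A B),
    exists D (k : hom D A), is_kernel f k;
  cokernels : forall (A B : C) (f : hom A B),
    exists D (q : hom B D), is_cokernel f q;
  mono_normal : forall (A B : C) (f : hom A B), is_mono f ->
    exists D (g : hom B D), is_kernel g f;
  epi_normal : forall (A B : C) (f : hom A B), is_epi f ->
    exists D (g : hom D A), is_cokernel g f
}.

Definition semisimple_category (K : fieldType) (C : linear_category K) : Prop :=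
  abelian_category C /\
  forall X : C, exists m (Y : 'I_m -> C),
    (forall a, simple_object (Y a)) /\ is_direct_sum Y X.

Definition simple_representatives (K : fieldType) (C : linear_category K)
    n (X : 'I_n -> C) : Prop :=
  [/\ forall i, simple_object (X i),
      forall i j, isomorphic (X i) (X j) -> i = j &
      forall Y : C, simple_object Y -> exists i, isomorphic Y (X i)].

Record monoidal_category (K : fieldType) := MonoidalCategory {
  mon_lin :> linear_category K;
  unit_obj : mon_lin;
  tens : mon_lin -> mon_lin -> mon_lin;
  tensm : forall A A' B B' : mon_lin,
    hom A A' -> hom B B' -> hom (tens A B) (tens A' B');
  tensm_id : forall A B : mon_lin, tensm (idm A) (idm B) = idm (tens A B);
  tensm_comp : forall (A A' A'' B B' B'' : mon_lin)
      (f' : hom A' A'') (f : hom A A') (g' : hom B' B'') (g : hom B B'),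
    tensm (f' ∘ f) (g' ∘ g) = tensm f' g' ∘ tensm f g;
  tensm_linl : forall (A A' B B' : mon_lin) a
      (f f' : hom A A') (g : hom B B'),
    tensm (a *: f + f') g = a *: tensm f g + tensm f' g;
  tensm_linr : forall (A A' B B' : mon_lin) a
      (f : hom A A') (g g' : hom B B'),
    tensm f (a *: g + g') = a *: tensm f g + tensm f g';
  assoc : forall A B D : mon_lin,
    hom (tens (tens A B) D) (tens A (tens B D));
  assocV : forall A B D : mon_lin,
    hom (tens A (tens B D)) (tens (tens A B) D);
  lunit : forall A : mon_lin, hom (tens unit_obj A) A;
  runit : forall A : mon_lin, hom (tens A unit_obj) A;
  assocK : forall A B D, assocV A B D ∘ assoc A B D = idm _;
  assocVK : forall A B D, assoc A B D ∘ assocV A B D = idm _;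
  assoc_nat : forall (A A' B B' D D' : mon_lin)
      (f : hom A A') (g : hom B B') (h : hom D D'),
    assoc A' B' D' ∘ tensm (tensm f g) h
      = tensm f (tensm g h) ∘ assoc A B D;
  lunit_iso : forall A, is_iso (lunit A);
  lunit_nat : forall (A B : mon_lin) (f : hom A B),
    lunit B ∘ tensm (idm unit_obj) f = f ∘ lunit A;
  runit_iso : forall A, is_iso (runit A);
  runit_nat : forall (A B : mon_lin) (f : hom A B),
    runit B ∘ tensm f (idm unit_obj) = f ∘ runit A;
  pentagon : forall A B D E : mon_lin,
    assoc A B (tens D E) ∘ assoc (tens A B) D E
      = tensm (idm A) (assoc B D E) ∘ assoc A (tens B D) E
          ∘ tensm (assoc A B D) (idm E);
  triangle : forall A B : mon_lin,
    tensm (idm A) (lunit B) ∘ assoc A unit_obj B = tensm (runit A) (idm B)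
}.

Arguments unit_obj {K} m.
Arguments tens {K m} A B.
Arguments tensm {K m A A' B B'} f g.
Arguments assoc {K m} A B D.
Arguments assocV {K m} A B D.
Arguments lunit {K m} A.
Arguments runit {K m} A.

Notation "A ⊗ B" := (tens A B) (at level 40, left associativity) : mor_scope.
Notation "f ⊠ g" := (tensm f g) (at level 40, left associativity) : mor_scope.

Record braided_category (K : fieldType) := BraidedCategory {
  br_mon :> monoidal_category K;
  braid : forall A B : br_mon, hom (A ⊗ B) (B ⊗ A);
  braid_iso : forall A B, is_iso (braid A B);
  braid_nat : forall (A A' B B' : br_mon) (f : hom A A') (g : hom B B'),
    braid A' B' ∘ (f ⊠ g) = (g ⊠ f) ∘ braid A B;
  hexagon1 : forall A B D : br_mon,
    assoc B D A ∘ braid A (B ⊗ D) ∘ assoc A B D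
      = (idm B ⊠ braid A D) ∘ assoc B A D ∘ (braid A B ⊠ idm D);
  hexagon2 : forall A B D : br_mon,
    assocV D A B ∘ braid (A ⊗ B) D ∘ assocV A B D
      = (braid A D ⊠ idm B) ∘ assocV A D B ∘ (idm A ⊠ braid B D)
}.

Arguments braid {K b} A B.

(* Left duals suffice for rigidity: in a braided category they are also
   right duals. *)
Record ribbon_category (K : fieldType) := RibbonCategory {
  rib_br :> braided_category K;
  dual : rib_br -> rib_br;
  ev : forall A : rib_br, hom (dual A ⊗ A) (unit_obj rib_br);
  coev : forall A : rib_br, hom (unit_obj rib_br) (A ⊗ dual A);
  zigzag1 : forall A : rib_br,
    runit A ∘ (idm A ⊠ ev A) ∘ assoc A (dual A) A ∘ (coev A ⊠ idm A)
      = lunit A;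
  zigzag2 : forall A : rib_br,
    lunit (dual A) ∘ (ev A ⊠ idm (dual A)) ∘ assocV (dual A) A (dual A)
        ∘ (idm (dual A) ⊠ coev A)
      = runit (dual A);
  twist : forall A : rib_br, hom A A;
  twist_iso : forall A, is_iso (twist A);
  twist_nat : forall (A B : rib_br) (f : hom A B),
    twist B ∘ f = f ∘ twist A;
  balancing : forall A B : rib_br,
    twist (A ⊗ B) = braid B A ∘ braid A B ∘ (twist A ⊠ twist B);
  ribbon_axiom : forall A : rib_br,
    (twist A ⊠ idm (dual A)) ∘ coev A
      = (idm A ⊠ twist (dual A)) ∘ coev A
}.

Arguments dual {K r} A.
Arguments ev {K r} A.
Arguments coev {K r} A.
Arguments twist {K r} A.

(* The scalar a with f = a * id_A, for f an endomorphism of a simple object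
   (the value is irrelevant when f is not a multiple of a nonzero id_A). *)
Definition scalar_of (K : fieldType) (C : linear_category K) (A : C)
    (f : hom A A) : K :=
  xget 0 [set a : K | f = a *: idm A].

Section ModularData.
Context {K : fieldType} {C : ribbon_category K}.

(* Quantum trace 1 -> A A^* -> A A^* -> A^* A -> 1, the twist and the braiding
   turning ev into a pairing A A^* -> 1. *)
Definition qtrace (A : C) (f : hom A A) : hom (unit_obj C) (unit_obj C) :=
  ev A ∘ braid A (dual A) ∘ ((twist A ∘ f) ⊠ idm (dual A)) ∘ coev A.

Definition qdim (A : C) : K := scalar_of (qtrace (idm A)).

Variables (n : nat) (X : 'I_n -> C).

Definition theta (i : 'I_n) : K := scalar_of (twist (X i)).

Definition fusion (i j k : 'I_n) : nat := \dim {: hom (X i ⊗ X j) (X k)}.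

(* N_{i^*, j}^k, computed with the object (X i)^* itself. *)
Definition fusion_dual (i j k : 'I_n) : nat :=
  \dim {: hom (dual (X i) ⊗ X j) (X k)}.

Definition smat (i j : 'I_n) : K :=
  (theta i * theta j)^-1
    * \sum_k (fusion_dual i j k)%:R * qdim (X k) * theta k.

Definition Smatrix : 'M[K]_n := \matrix_(i, j) smat i j.

(* psi i j is the value of the character psi_i on the class of X j. *)
Definition psi (i j : 'I_n) : K := smat i j / qdim (X i).

End ModularData.

(* Invertibility of the S-matrix does not depend on the representatives. *)
Record modular_category (R : realType) := ModularCategory {
  modc_rib :> ribbon_category R[i];
  modc_semisimple : semisimple_category modc_rib;
  modc_finite : exists n (X : 'I_n -> modc_rib), simple_representatives X;
  modc_unit : simple_object (unit_obj modc_rib);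
  modc_Smatrix : forall n (X : 'I_n -> modc_rib),
    simple_representatives X -> Smatrix X \in unitmx
}.

(* The smallest subfield containing S; in characteristic 0 this is Q(S). *)
Definition subfield_gen (F : fieldType) (S : set F) : set F :=
  [set x | forall L : {pred F}, divring_closed L ->
     (forall y, S y -> y \in L) -> x \in L].

(* s restricts to a field automorphism of L; in characteristic 0 it fixes Q,
   so that these restrictions form Gal(L/Q). Values of s off L are ignored. *)
Definition field_automorphism (F : fieldType) (L : set F) (s : F -> F) : Prop :=
  [/\ set_bij L L s, s 1 = 1,
      forall x y, L x -> L y -> s (x + y) = s x + s y &
      forall x y, L x -> L y -> s (x * y) = s x * s y].

Definition smat_field (K : fieldType) (C : ribbon_category K) n
    (X : 'I_n -> C) : set K :=
  subfield_gen [set x | exists i j, x = smat X i j].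

(* The image of Gal(Q(smat)/Q) in 'S_n under s |-> p, s \o psi_i = psi_(p i). *)
Definition galois_perms (K : fieldType) (C : ribbon_category K) n
    (X : 'I_n -> C) : {set 'S_n} :=
  [set p : 'S_n | `[< exists s, field_automorphism (smat_field X) s /\
     forall i j, s (psi X i j) = psi X (p i) j >] ]%SET.

(* Products in 'S_n apply the left factor first. *)
Definition cycle_012 : 'S_5 := (tperm 0%R 1%R * tperm 0%R 2%R)%g.
Definition cycle_34 : 'S_5 := tperm 3%R 4%R.

Fact cycle_012E : [/\ cycle_012 0 = 1, cycle_012 1 = 2, cycle_012 2 = 0,
  cycle_012 3 = 3 & cycle_012 4 = 4].
Proof. by rewrite /cycle_012; split; rewrite permM !permE; apply/val_inj. Qed.

Fact cycle_34E : [/\ cycle_34 0 = 0, cycle_34 1 = 1, cycle_34 2 = 2,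
  cycle_34 3 = 4 & cycle_34 4 = 3].
Proof. by rewrite /cycle_34; split; rewrite permE; apply/val_inj. Qed.

(* Structure constants N of a based ring with Z-basis b_0, ..., b_(n-1):
   b_i b_j = \sum_k N i j k b_k. The underlying group is 'rV[int]_n. *)
Definition structure_constants n := 'I_n -> 'I_n -> 'I_n -> nat.

Definition based_elt n (i : 'I_n) : 'rV[int]_n := delta_mx 0 i.

Definition based_mul n (N : structure_constants n) (x y : 'rV[int]_n) :
    'rV[int]_n :=
  \sum_i \sum_j \sum_k (x 0 i * y 0 j * (N i j k)%:Z) *: based_elt k.

(* The identity is the basis element of index 0. *)
Definition based_ring_isomorphic n (N N' : structure_constants n.+1) : Prop :=
  exists phi : {additive 'rV[int]_n.+1 -> 'rV[int]_n.+1},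
    [/\ bijective phi,
        phi (based_elt ord0) = based_elt ord0,
        forall x y, phi (based_mul N x y) = based_mul N' (phi x) (phi y) &
        phi @` range (@based_elt n.+1) = range (@based_elt n.+1)].

Definition mx5 (s : seq (seq nat)) : 'M[nat]_5 :=
  \matrix_(i, j) nth 0%N (nth [::] s i) j.

Definition SU34Z3_N1 : 'M[nat]_5 := mx5
  [:: [:: 0; 1; 0; 0; 0];
      [:: 1; 2; 1; 1; 1];
      [:: 0; 1; 1; 1; 1];
      [:: 0; 1; 1; 1; 0];
      [:: 0; 1; 1; 0; 1]]%N.

Definition SU34Z3_N2 : 'M[nat]_5 := mx5
  [:: [:: 0; 0; 1; 0; 0];
      [:: 0; 1; 1; 1; 1];
      [:: 1; 1; 1; 0; 0];
      [:: 0; 1; 0; 0; 1];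
      [:: 0; 1; 0; 1; 0]]%N.

Definition SU34Z3_N3 : 'M[nat]_5 := mx5
  [:: [:: 0; 0; 0; 0; 1];
      [:: 0; 1; 1; 0; 1];
      [:: 0; 1; 0; 1; 0];
      [:: 1; 1; 0; 0; 0];
      [:: 0; 0; 1; 1; 0]]%N.

Definition SU34Z3_N (i : 'I_5) : 'M[nat]_5 :=
  nth 0 [:: 1%:M; SU34Z3_N1; SU34Z3_N2; SU34Z3_N3; SU34Z3_N3^T] i.

(* Y_i Y_j = \sum_k (N_i)_(k, j) Y_k: the column index is the right factor. *)
Definition Gr_SU34Z3 : structure_constants 5 :=
  fun i j k => SU34Z3_N i k j.

(* Main.v *)
Require Import Defs.
From mathcomp Require Import all_boot all_order all_algebra all_fingroup.
From mathcomp Require Import reals complex.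
From mathcomp Require Import boolp classical_sets functions ring lra zify.
From HB Require Import structures.
Import Defs.

(** The proof has a categorical and an arithmetic half.

    The first half reduces the category to numbers.  A loop coloured X_j drawn
    around the strand X_i acts as a scalar chi_i(j), and a loop coloured by a
    tensor product is a pair of nested loops, so that chi_i is a character of
    the Grothendieck ring ([chiM]).  Computing the trace of the twist of
    X_i ⊗ X_j through its decomposition, and through the double braiding, gives
    sum_k N_ij^k d_k theta_k = theta_i theta_j d_i chi_i(j) ([balancing_chi]),
    which identifies chi with the rows of the S-matrix.  The string diagrams are
    handled by letting each object act through its tensor product from the left,
    where composition is strictly associative.

    In the second half, invertibility of S makes the characters orthogonal with
    equal norms ([dS_norm]), and S and the twists satisfy the relation of the
    modular group ([modular_relation]).  The automorphism inducing (0 1 2) maps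
    D^2 / d_i^2, a sum of values of the i-th character, to the next such number;
    this forces s_1j = ± d_(j+1) and determines S, apart from two signs h1, h2
    and the number b = psi_3(3), in terms of d_1, d_2, d_3 ([galois_signs]).

    Put r = b + conj b.  Orthogonality gives 2 |b|^2 = r^2 + 3 and
    D^2 = (r^2 + 6) d_3^2, and two identities in the Grothendieck ring, which it
    suffices to check on the five characters, show that r is an integer and
    express traces of fusion matrices through r ([fusion_34_33],
    [fusion_casimir]).  Together with associativity this leaves, for each r, the
    integral points of a conic ([arith_table]).  The twists bound r: the modular
    relation is a quadratic system for them with only one solution that is not
    constant ([hankel_unique]), and since the complex conjugate of the inverse of
    a solution is again a solution, the twists have modulus one.  A sum of three
    of them has squared modulus r^2 (r^2 + 3) / 2, whence |r| <= 1
    ([twist_bound]).  As r^2 + 3 is even, r is 1 or -1; for these values the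
    conic is a factorization of 7, and one point is left, up to the exchange of
    X_1 and X_2: the fusion rules of SU(3)_4/Z_3. *)

Set Implicit Arguments.
Unset Strict Implicit.
Unset Printing Implicit Defensive.

Import Order.TTheory GRing.Theory Num.Theory.
Local Open Scope ring_scope.
Local Open Scope mor_scope.

(** * Composition in a linear category *)

Section Linear.
Context {K : fieldType} {C : linear_category K}.
Implicit Types A B D E : C.

(** Composites are kept bracketed to the left, so that an equation between
   composites has to be applied behind an arbitrary last factor. *)
Lemma comp_tail A B D E (f : hom A B) (g : hom B D) (h : hom A D) :
  g ∘ f = h -> forall k : hom D E, k ∘ g ∘ f = k ∘ h.
Proof. by move=> e k; rewrite -comp_assoc e. Qed.

Lemma comp_tail3 A B B' D E (f : hom A B) (g : hom B B') (g' : hom B' D)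
    (h : hom A D) :
  g' ∘ g ∘ f = h -> forall k : hom D E, k ∘ g' ∘ g ∘ f = k ∘ h.
Proof. by move=> e k; rewrite -!comp_assoc [g' ∘ _]comp_assoc e. Qed.

Lemma comp_tail4 A A' B B' D E (f0 : hom A A') (f : hom A' B) (g : hom B B')
    (g' : hom B' D) (h : hom A D) :
  g' ∘ g ∘ f ∘ f0 = h -> forall k : hom D E, k ∘ g' ∘ g ∘ f ∘ f0 = k ∘ h.
Proof. by move=> <- k; rewrite !comp_assoc. Qed.

Lemma iso_monic A B (f : hom A B) : is_iso f ->
  forall D (g h : hom D A), f ∘ g = f ∘ h -> g = h.
Proof.
case=> f' [ff' f'f] D g h e.
by rewrite -[g]comp_idl -[h]comp_idl -ff' -!comp_assoc e.
Qed.

Lemma iso_epic A B (f : hom A B) : is_iso f ->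
  forall D (g h : hom B D), g ∘ f = h ∘ f -> g = h.
Proof.
case=> f' [ff' f'f] D g h e.
by rewrite -[g]comp_idr -[h]comp_idr -f'f !comp_assoc e.
Qed.

Lemma comp0r A B D (g : hom B D) : g ∘ (0 : hom A B) = 0.
Proof.
have := comp_linr 1 g (0 : hom A B) 0.
by rewrite !scale1r addr0 => /(congr1 (fun x => x - g ∘ 0)); rewrite addrK subrr.
Qed.

Lemma comp0l A B D (f : hom A B) : (0 : hom B D) ∘ f = 0.
Proof.
have := comp_linl 1 (0 : hom B D) 0 f.
by rewrite !scale1r addr0 => /(congr1 (fun x => x - 0 ∘ f)); rewrite addrK subrr.
Qed.

Lemma comp_scaler A B D a (g : hom B D) (f : hom A B) :
  g ∘ (a *: f) = a *: (g ∘ f).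
Proof. by rewrite -[a *: f]addr0 comp_linr comp0r addr0. Qed.

Lemma comp_scalel A B D a (g : hom B D) (f : hom A B) :
  (a *: g) ∘ f = a *: (g ∘ f).
Proof. by rewrite -[a *: g]addr0 comp_linl comp0l addr0. Qed.

Lemma comp_addr A B D (g : hom B D) (f f' : hom A B) :
  g ∘ (f + f') = g ∘ f + g ∘ f'.
Proof. by rewrite -[f]scale1r comp_linr !scale1r. Qed.

Lemma comp_addl A B D (g g' : hom B D) (f : hom A B) :
  (g + g') ∘ f = g ∘ f + g' ∘ f.
Proof. by rewrite -[g]scale1r comp_linl !scale1r. Qed.

End Linear.

(** * Coherence in monoidal and braided categories *)

Section Monoidal.
Context {K : fieldType} {C : monoidal_category K}.
Implicit Types A B D X Y Z : C.

Local Notation "A ◁ g" := (idm A ⊠ g) (at level 35, right associativity).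
Local Notation "f ▷ X" := (f ⊠ idm X) (at level 35, right associativity).

Lemma lwcomp A X Y Z (g : hom Y Z) (f : hom X Y) :
  A ◁ (g ∘ f) = (A ◁ g) ∘ (A ◁ f).
Proof. by rewrite -tensm_comp comp_idl. Qed.

Lemma rwcomp A X Y Z (g : hom Y Z) (f : hom X Y) :
  (g ∘ f) ▷ A = (g ▷ A) ∘ (f ▷ A).
Proof. by rewrite -tensm_comp comp_idl. Qed.

Lemma interchange A B X Y (f : hom A B) (g : hom X Y) :
  (B ◁ g) ∘ (f ▷ X) = (f ▷ Y) ∘ (A ◁ g).
Proof. by rewrite -!tensm_comp !comp_idl !comp_idr. Qed.

Lemma assoc_nat1 A A' B D (f : hom A A') :
  assoc A' B D ∘ ((f ▷ B) ▷ D) = (f ▷ (B ⊗ D)) ∘ assoc A B D.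
Proof. by rewrite assoc_nat tensm_id. Qed.

Lemma assoc_nat2 A B B' D (f : hom B B') :
  assoc A B' D ∘ ((A ◁ f) ▷ D) = (A ◁ (f ▷ D)) ∘ assoc A B D.
Proof. exact: assoc_nat. Qed.

Lemma assoc_nat3 A B D D' (f : hom D D') :
  assoc A B D' ∘ ((A ⊗ B) ◁ f) = (A ◁ (B ◁ f)) ∘ assoc A B D.
Proof. by rewrite -tensm_id assoc_nat. Qed.

Lemma assoc_iso A B D : is_iso (assoc A B D).
Proof. by exists (assocV A B D); rewrite assocK assocVK. Qed.

Lemma assocV_iso A B D : is_iso (assocV A B D).
Proof. by exists (assoc A B D); rewrite assocK assocVK. Qed.

Lemma lw_iso A B D (f : hom B D) : is_iso f -> is_iso (A ◁ f).
Proof.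
by case=> g [fg gf]; exists (A ◁ g); rewrite -!lwcomp fg gf !tensm_id.
Qed.

Lemma rw_iso A B D (f : hom B D) : is_iso f -> is_iso (f ▷ A).
Proof.
by case=> g [fg gf]; exists (g ▷ A); rewrite -!rwcomp fg gf !tensm_id.
Qed.

Lemma assocV_nat1 A A' B D (f : hom A A') :
  assocV A' B D ∘ (f ▷ (B ⊗ D)) = ((f ▷ B) ▷ D) ∘ assocV A B D.
Proof.
apply: (iso_monic (assoc_iso _ _ _)).
by rewrite !comp_assoc assocVK comp_idl assoc_nat1 -comp_assoc assocVK comp_idr.
Qed.

Lemma assocV_nat2 A B B' D (f : hom B B') :
  assocV A B' D ∘ (A ◁ (f ▷ D)) = ((A ◁ f) ▷ D) ∘ assocV A B D.
Proof.
apply: (iso_monic (assoc_iso _ _ _)).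
by rewrite !comp_assoc assocVK comp_idl assoc_nat2 -comp_assoc assocVK comp_idr.
Qed.

Lemma assocV_nat3 A B D D' (f : hom D D') :
  assocV A B D' ∘ (A ◁ (B ◁ f)) = ((A ⊗ B) ◁ f) ∘ assocV A B D.
Proof.
apply: (iso_monic (assoc_iso _ _ _)).
by rewrite !comp_assoc assocVK comp_idl assoc_nat3 -comp_assoc assocVK comp_idr.
Qed.

Lemma tensm0l A A' B B' (g : hom B B') : (0 : hom A A') ⊠ g = 0.
Proof.
have := tensm_linl 1 (0 : hom A A') 0 g.
by rewrite !scale1r addr0 => /(congr1 (fun x => x - 0 ⊠ g)); rewrite addrK subrr.
Qed.

Lemma tensm0r A A' B B' (f : hom A A') : f ⊠ (0 : hom B B') = 0.
Proof.
have := tensm_linr 1 f (0 : hom B B') 0.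
by rewrite !scale1r addr0 => /(congr1 (fun x => x - f ⊠ 0)); rewrite addrK subrr.
Qed.

Lemma tensm_scalel A A' B B' a (f : hom A A') (g : hom B B') :
  (a *: f) ⊠ g = a *: (f ⊠ g).
Proof. by rewrite -[a *: f]addr0 tensm_linl tensm0l addr0. Qed.

Lemma tensm_scaler A A' B B' a (f : hom A A') (g : hom B B') :
  f ⊠ (a *: g) = a *: (f ⊠ g).
Proof. by rewrite -[a *: g]addr0 tensm_linr tensm0r addr0. Qed.

Lemma tensm_addl A A' B B' (f f' : hom A A') (g : hom B B') :
  (f + f') ⊠ g = f ⊠ g + f' ⊠ g.
Proof. by rewrite -[f]scale1r tensm_linl !scale1r. Qed.

Lemma tensm_addr A A' B B' (f : hom A A') (g g' : hom B B') :
  f ⊠ (g + g') = f ⊠ g + f ⊠ g'.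
Proof. by rewrite -[g]scale1r tensm_linr !scale1r. Qed.

Lemma lw1_inj X Y (f g : hom X Y) :
  unit_obj C ◁ f = unit_obj C ◁ g -> f = g.
Proof.
move=> e; apply: (iso_epic (lunit_iso X)).
by rewrite -!lunit_nat e.
Qed.

Lemma rw1_inj X Y (f g : hom X Y) :
  f ▷ unit_obj C = g ▷ unit_obj C -> f = g.
Proof.
move=> e; apply: (iso_epic (runit_iso X)).
by rewrite -!runit_nat e.
Qed.

(** Kelly's argument: whiskered with the unit, the claim is a face of a pentagon
   all of whose other faces commute; whiskering with the unit is faithful. *)
Lemma lunit_tens A B :
  lunit (A ⊗ B) ∘ assoc (unit_obj C) A B = lunit A ▷ B.
Proof.
set I := unit_obj C.
apply: lw1_inj; rewrite lwcomp.
apply: (iso_epic (assoc_iso I (I ⊗ A) B)).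
apply: (iso_epic (rw_iso B (assoc_iso I I A))).
rewrite -!comp_assoc [(I ◁ assoc _ _ _) ∘ _]comp_assoc -pentagon.
rewrite [LHS]comp_assoc triangle -assoc_nat1.
by rewrite [RHS]comp_assoc -assoc_nat2 -comp_assoc -rwcomp triangle.
Qed.

Lemma runit_tens A B :
  (A ◁ runit B) ∘ assoc A B (unit_obj C) = runit (A ⊗ B).
Proof.
set I := unit_obj C.
apply: rw1_inj; rewrite rwcomp.
apply: (iso_monic (assoc_iso _ _ _)).
rewrite comp_assoc assoc_nat2 -!triangle.
rewrite lwcomp [RHS]comp_assoc assoc_nat3.
by rewrite -!comp_assoc pentagon !comp_assoc.
Qed.

Lemma lunit1 : lunit (unit_obj C) = runit (unit_obj C).
Proof.
set I := unit_obj C.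
have e1 : I ◁ lunit I = lunit (I ⊗ I).
  by apply: (iso_monic (lunit_iso I)); rewrite lunit_nat.
apply: rw1_inj; rewrite -lunit_tens -triangle e1.
by [].
Qed.

End Monoidal.

Section MonoidalMore.
Context {K : fieldType} {C : monoidal_category K}.
Implicit Types A B D E X Y Z : C.

Lemma pentagonV A B D E :
  assoc A B (D ⊗ E) ∘ assoc (A ⊗ B) D E ∘ (assocV A B D ⊠ idm E)
    = (idm A ⊠ assoc B D E) ∘ assoc A (B ⊗ D) E.
Proof.
by rewrite pentagon -comp_assoc -rwcomp assocVK tensm_id comp_idr.
Qed.

Definition lunitV A : hom A (unit_obj C ⊗ A) := projT1 (cid (lunit_iso A)).

Lemma lunitK A : lunitV A ∘ lunit A = idm _.
Proof. by rewrite /lunitV; case: cid => g []. Qed.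

Lemma lunitVK A : lunit A ∘ lunitV A = idm _.
Proof. by rewrite /lunitV; case: cid => g []. Qed.

Lemma lunitV_nat A B (f : hom A B) :
  lunitV B ∘ f = (idm (unit_obj C) ⊠ f) ∘ lunitV A.
Proof.
apply: (iso_monic (lunit_iso B)).
by rewrite !comp_assoc lunitVK comp_idl lunit_nat -comp_assoc lunitVK comp_idr.
Qed.

End MonoidalMore.

Section Braided.
Context {K : fieldType} {C : braided_category K}.
Implicit Types A B D E X Y Z : C.
Local Notation "A ◁ g" := (idm A ⊠ g) (at level 35, right associativity).
Local Notation "f ▷ X" := (f ⊠ idm X) (at level 35, right associativity).


Lemma lunit_braid A : lunit A ∘ braid A (unit_obj C) = runit A.
Proof.
apply: rw1_inj; rewrite rwcomp.
apply: (iso_monic (braid_iso A (unit_obj C))).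
have := hexagon1 A (unit_obj C) (unit_obj C).
move/(congr1 (comp (lunit _))); rewrite !comp_assoc.
rewrite lunit_tens -braid_nat lunit_nat.
rewrite -comp_assoc triangle => ->.
by rewrite (comp_tail (lunit_tens _ _)).
Qed.

Lemma runit_braid A : runit A ∘ braid (unit_obj C) A = lunit A.
Proof.
apply: lw1_inj; rewrite lwcomp.
apply: (iso_monic (braid_iso (unit_obj C) A)).
have := hexagon2 (unit_obj C) (unit_obj C) A.
move/(congr1 (comp (runit _))); rewrite !comp_assoc runit_nat.
rewrite -!runit_tens !comp_assoc !(comp_tail (assocVK _ _ _)) !comp_idr.
rewrite -braid_nat -triangle !comp_assoc (comp_tail (assocVK _ _ _)) comp_idr.
by move=> ->.
Qed.

(** From here on an object A is identified with the functor A ⊗ -.  A word in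
   such functors acts on a spectator X, morphisms of words are families indexed
   by X, and composition of functors is strictly associative: no associator is
   left in the identities below.  The definitions are locked to prevent the
   rewriting of composites from unfolding them. *)
Definition br A B X : hom (A ⊗ (B ⊗ X)) (B ⊗ (A ⊗ X)) :=
  locked (assoc B A X ∘ (braid A B ▷ X) ∘ assocV A B X).

Lemma brE A B X :
  br A B X = assoc B A X ∘ (braid A B ▷ X) ∘ assocV A B X.
Proof. by rewrite /br -lock. Qed.

Lemma br_assoc A B X :
  br A B X ∘ assoc A B X = assoc B A X ∘ (braid A B ▷ X).
Proof. by rewrite !brE -comp_assoc assocK comp_idr. Qed.

Lemma rw_eq X A B D E (f : hom B D) (g : hom A B) (f' : hom E D) (g' : hom A E) :
  f ∘ g = f' ∘ g' -> (f ▷ X) ∘ (g ▷ X) = (f' ▷ X) ∘ (g' ▷ X).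
Proof. by rewrite -!rwcomp => ->. Qed.

Lemma lw_eq X A B D E (f : hom B D) (g : hom A B) (f' : hom E D) (g' : hom A E) :
  f ∘ g = f' ∘ g' -> (X ◁ f) ∘ (X ◁ g) = (X ◁ f') ∘ (X ◁ g').
Proof. by rewrite -!lwcomp => ->. Qed.

Lemma lw_idm X A B (f : hom B A) (g : hom A B) :
  f ∘ g = idm A -> (X ◁ f) ∘ (X ◁ g) = idm (X ⊗ A).
Proof. by rewrite -lwcomp => ->; rewrite tensm_id. Qed.

Lemma lw_eq3 X A B B' D (f : hom B' D) (g : hom B B') (h : hom A B)
    (k : hom A D) :
  f ∘ g ∘ h = k -> (X ◁ f) ∘ (X ◁ g) ∘ (X ◁ h) = X ◁ k.
Proof. by rewrite -!lwcomp => ->. Qed.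

Lemma br_nat1 A A' B X (f : hom A A') :
  br A' B X ∘ (f ▷ (B ⊗ X)) = (B ◁ f ▷ X) ∘ br A B X.
Proof.
rewrite !brE (comp_tail (assocV_nat1 _ _ _)) !comp_assoc.
by rewrite (comp_tail (rw_eq _ (braid_nat _ _))) !comp_assoc assoc_nat2.
Qed.

Lemma br_nat2 A B B' X (f : hom B B') :
  br A B' X ∘ (A ◁ f ▷ X) = (f ▷ (A ⊗ X)) ∘ br A B X.
Proof.
rewrite !brE (comp_tail (assocV_nat2 _ _ _)) !comp_assoc.
by rewrite (comp_tail (rw_eq _ (braid_nat _ _))) !comp_assoc assoc_nat1.
Qed.

Lemma br_nat3 A B X Y (f : hom X Y) :
  br A B Y ∘ (A ◁ B ◁ f) = (B ◁ A ◁ f) ∘ br A B X.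
Proof.
rewrite !brE (comp_tail (assocV_nat3 _ _ _)) !comp_assoc.
by rewrite (comp_tail (esym (interchange _ _))) !comp_assoc assoc_nat3.
Qed.

(** The hexagons, freed of associators: a strand crosses a tensor product by
   crossing its factors one after the other. *)
Lemma br_tens_r A B D X :
  assoc B D (A ⊗ X) ∘ br A (B ⊗ D) X
    = (B ◁ br A D X) ∘ br A B (D ⊗ X) ∘ (A ◁ assoc B D X).
Proof.
apply: (iso_epic (assoc_iso A (B ⊗ D) X)).
apply: (iso_epic (rw_iso X (assoc_iso A B D))).
rewrite (comp_tail (br_assoc _ _ _)) !comp_assoc.
rewrite [in RHS](comp_tail3 (esym (pentagon _ _ _ _))) !comp_assoc.
rewrite [in RHS](comp_tail (br_assoc _ _ _)) !comp_assoc.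
rewrite [in RHS](comp_tail (esym (assoc_nat1 _ _ _))) !comp_assoc pentagon.
have /(congr1 (fun f => f ▷ X)) := hexagon1 A B D; rewrite /= !rwcomp => e.
rewrite (comp_tail3 e) !comp_assoc (comp_tail (assoc_nat2 _ _ _)) !comp_assoc.
congr (_ ∘ _); rewrite -[RHS]comp_assoc pentagon !comp_assoc.
by rewrite -!lwcomp br_assoc.
Qed.

Lemma br_tens_l A B D X :
  (D ◁ assoc A B X) ∘ br (A ⊗ B) D X
    = br A D (B ⊗ X) ∘ (A ◁ br B D X) ∘ assoc A B (D ⊗ X).
Proof.
apply: (iso_epic (assoc_iso (A ⊗ B) D X)).
apply: (iso_epic (rw_iso X (assocV_iso A B D))).
rewrite (comp_tail (br_assoc _ _ _)) !comp_assoc.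
rewrite [in RHS](comp_tail3 (pentagonV _ _ _ _)) !comp_assoc.
rewrite [in RHS](comp_tail (lw_eq _ (br_assoc _ _ _))) !comp_assoc.
rewrite [in RHS](comp_tail (esym (assoc_nat2 _ _ _))) !comp_assoc.
rewrite -[br A D _ ∘ _ ∘ _](comp_assoc) -!pentagonV !comp_assoc br_assoc.
have /(congr1 (fun f => f ▷ X)) := hexagon2 A B D; rewrite /= !rwcomp => e.
by rewrite (comp_tail3 e) !comp_assoc (comp_tail (assoc_nat1 _ _ _)) !comp_assoc.
Qed.

Lemma br_unit_l D X :
  (D ◁ lunit X) ∘ br (unit_obj C) D X = lunit (D ⊗ X).
Proof.
rewrite brE !comp_assoc triangle -rwcomp runit_braid -lunit_tens.
by rewrite -comp_assoc assocVK comp_idr.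
Qed.

Lemma br_unit_r D X :
  lunit (D ⊗ X) ∘ br D (unit_obj C) X = D ◁ lunit X.
Proof.
rewrite brE !comp_assoc lunit_tens -rwcomp lunit_braid -triangle.
by rewrite -comp_assoc assocVK comp_idr.
Qed.

Lemma br_unitV_r D X :
  br D (unit_obj C) X ∘ (D ◁ lunitV X) = lunitV (D ⊗ X).
Proof.
apply: (iso_monic (lunit_iso _)).
by rewrite comp_assoc br_unit_r -lwcomp !lunitVK tensm_id.
Qed.

(** A strand that passes in front of a crossing: br_nat1 for the crossing. *)
Lemma yang_baxter A B D X :
  (D ◁ br A B X) ∘ br A D (B ⊗ X) ∘ (A ◁ br B D X)
    = br B D (A ⊗ X) ∘ (B ◁ br A D X) ∘ br A B (D ⊗ X).
Proof.
apply: (iso_epic (assoc_iso A B (D ⊗ X))).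
rewrite -2!(comp_assoc (D ◁ _)) -br_tens_l comp_assoc -lwcomp br_assoc.
rewrite lwcomp -comp_assoc -br_nat1 comp_assoc br_tens_l.
by rewrite -comp_assoc -br_assoc !comp_assoc.
Qed.

End Braided.

(** * Duals, loops and traces in a ribbon category *)

Section Ribbon.
Context {K : fieldType} {C : ribbon_category K}.
Implicit Types A B D E X Y Z V S : C.
Local Notation "A ◁ g" := (idm A ⊠ g) (at level 35, right associativity).
Local Notation "f ▷ X" := (f ⊠ idm X) (at level 35, right associativity).

Definition evL A X : hom (dual A ⊗ (A ⊗ X)) X :=
  locked (lunit X ∘ (ev A ▷ X) ∘ assocV (dual A) A X).

Lemma evLE A X :
  evL A X = lunit X ∘ (ev A ▷ X) ∘ assocV (dual A) A X.
Proof. by rewrite /evL -lock. Qed.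

Definition coevL A X : hom X (A ⊗ (dual A ⊗ X)) :=
  locked (assoc A (dual A) X ∘ (coev A ▷ X) ∘ lunitV X).

Lemma coevLE A X :
  coevL A X = assoc A (dual A) X ∘ (coev A ▷ X) ∘ lunitV X.
Proof. by rewrite /coevL -lock. Qed.

Lemma evL_nat A X Y (h : hom X Y) :
  evL A Y ∘ (dual A ◁ A ◁ h) = h ∘ evL A X.
Proof.
rewrite !evLE ?comp_assoc (comp_tail (assocV_nat3 _ _ _)) ?comp_assoc.
by rewrite (comp_tail (esym (interchange _ _))) ?comp_assoc lunit_nat.
Qed.

Lemma coevL_nat A X Y (h : hom X Y) :
  coevL A Y ∘ h = (A ◁ dual A ◁ h) ∘ coevL A X.
Proof.
rewrite !coevLE (comp_tail (lunitV_nat _)) ?comp_assoc.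
by rewrite (comp_tail (esym (interchange _ _))) ?comp_assoc assoc_nat3.
Qed.

Lemma zigzagL1 A X : (A ◁ evL A X) ∘ coevL A (A ⊗ X) = idm _.
Proof.
rewrite evLE coevLE ?comp_assoc !lwcomp.
apply: (iso_epic (lunit_iso _)); rewrite comp_idl (comp_tail (lunitK _)) comp_idr.
apply: (iso_epic (assoc_iso (unit_obj C) A X)).
rewrite (comp_tail (esym (assoc_nat1 _ _ _))) ?comp_assoc.
rewrite (comp_tail (pentagon _ _ _ _)).
rewrite ?comp_assoc (comp_tail (esym (lwcomp _ _ _))) assocK tensm_id comp_idr.
rewrite (comp_tail (esym (assoc_nat2 _ _ _))) ?comp_assoc triangle.
by rewrite -!rwcomp zigzag1 lunit_tens.
Qed.

Lemma zigzagL2 A X : evL A (dual A ⊗ X) ∘ (dual A ◁ coevL A X) = idm _.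
Proof.
rewrite evLE coevLE ?comp_assoc !lwcomp ?comp_assoc.
apply: (iso_epic (lw_iso _ (lunit_iso _))).
rewrite comp_idl (comp_tail (esym (lwcomp _ _ _))) lunitK tensm_id comp_idr.
apply: (iso_epic (assoc_iso (dual A) (unit_obj C) X)).
rewrite (comp_tail (esym (assoc_nat2 _ _ _))) ?comp_assoc.
rewrite (comp_tail (esym (pentagonV _ _ _ _))) ?comp_assoc.
rewrite (comp_tail (assocK _ _ _)) comp_idr.
rewrite (comp_tail (esym (assoc_nat1 _ _ _))) ?comp_assoc lunit_tens.
by rewrite -!rwcomp zigzag2 triangle.
Qed.

(** A strand slides over a cap or a cup: the braiding is natural in ev and coev,
   and a strand crosses the unit object trivially. *)
Lemma slide_ev_r A D X :
  evL A (D ⊗ X) ∘ (dual A ◁ br D A X) ∘ br D (dual A) (A ⊗ X) = D ◁ evL A X.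
Proof.
apply: (iso_epic (lw_iso _ (assoc_iso _ _ _))).
rewrite -!(comp_assoc (evL _ _)) -br_tens_r evLE ?comp_assoc.
rewrite (comp_tail (assocK _ _ _)) comp_idr.
rewrite (comp_tail (esym (br_nat2 _ _ _))) ?comp_assoc br_unit_r.
rewrite evLE -lwcomp -!(comp_assoc (lunit X)) -lwcomp -!comp_assoc assocK comp_idr.
by [].
Qed.

Lemma slide_coev A D X :
  (A ◁ br D (dual A) X) ∘ br D A (dual A ⊗ X) ∘ (D ◁ coevL A X)
    = coevL A (D ⊗ X).
Proof.
rewrite coevLE !lwcomp ?comp_assoc -br_tens_r.
rewrite (comp_tail (br_nat2 _ _ _)) ?comp_assoc.
by rewrite (comp_tail (br_unitV_r _ _)) coevLE.
Qed.

(** Half of the adjunction of A^* ⊗ - and A ⊗ -; duals of morphisms and of tensor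
   products are defined by it. *)
Definition transp A V X (g : hom X (A ⊗ V)) : hom (dual A ⊗ X) V :=
  locked (evL A V ∘ (dual A ◁ g)).

Lemma transpE A V X (g : hom X (A ⊗ V)) :
  transp g = evL A V ∘ (dual A ◁ g).
Proof. by rewrite /transp -lock. Qed.

Lemma transpK A V X (g : hom X (A ⊗ V)) : (A ◁ transp g) ∘ coevL A X = g.
Proof.
by rewrite transpE lwcomp -comp_assoc -coevL_nat comp_assoc zigzagL1 comp_idl.
Qed.

Lemma transp_nat A V W X (g : hom X (A ⊗ V)) (h : hom V W) :
  h ∘ transp g = transp ((A ◁ h) ∘ g).
Proof. by rewrite !transpE lwcomp comp_assoc -evL_nat ?comp_assoc. Qed.

Lemma slide_transp A V X D (g : hom X (A ⊗ V)) :
  D ◁ transp g = transp (br D A V ∘ (D ◁ g)) ∘ br D (dual A) X.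
Proof.
rewrite !transpE !lwcomp -slide_ev_r ?comp_assoc.
by rewrite (comp_tail (br_nat3 _ _ _)) ?comp_assoc.
Qed.

(** The other evaluation A A^* -> 1.  The twist makes it, together with coev, a
   pivotal structure; the quantum trace closes up with it. *)
Definition evr A X : hom (A ⊗ (dual A ⊗ X)) X :=
  locked (evL A X ∘ br A (dual A) X ∘ (twist A ▷ (dual A ⊗ X))).

Lemma evrE A X :
  evr A X = evL A X ∘ br A (dual A) X ∘ (twist A ▷ (dual A ⊗ X)).
Proof. by rewrite /evr -lock. Qed.

Definition dualm B B' (f : hom B B') X : hom (dual B' ⊗ X) (dual B ⊗ X) :=
  transp ((f ▷ (dual B ⊗ X)) ∘ coevL B X).

Lemma dualm_coev B B' (f : hom B B') X :
  (f ▷ (dual B ⊗ X)) ∘ coevL B X = (B' ◁ dualm f X) ∘ coevL B' X.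
Proof. by rewrite transpK. Qed.

Lemma dualm_evL B B' (f : hom B B') X :
  evL B X ∘ dualm f (B ⊗ X) = evL B' X ∘ (dual B' ◁ f ▷ X).
Proof.
rewrite /dualm transp_nat comp_assoc interchange -comp_assoc zigzagL1 comp_idr.
by rewrite transpE.
Qed.

Lemma slide_dualm B B' (f : hom B B') D X :
  br D (dual B) X ∘ (D ◁ dualm f X) = dualm f (D ⊗ X) ∘ br D (dual B') X.
Proof.
rewrite /dualm slide_transp ?comp_assoc transp_nat; congr (transp _ ∘ _).
rewrite lwcomp ?comp_assoc (comp_tail (br_nat2 _ _ _)) ?comp_assoc interchange.
by rewrite -!comp_assoc; congr (_ ∘ _); rewrite ?comp_assoc slide_coev.
Qed.

(** Both coev and evr move f to its dual, whence cyclicity of traces and loops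
   ([trLC], [loopC]). *)
Lemma dualm_evr B B' (f : hom B B') X :
  evr B' X ∘ (f ▷ (dual B' ⊗ X)) = evr B X ∘ (B ◁ dualm f X).
Proof.
rewrite !evrE -!comp_assoc -rwcomp twist_nat rwcomp -interchange ?comp_assoc.
congr (_ ∘ _); rewrite (comp_tail (br_nat1 _ _ _)) ?comp_assoc -dualm_evL.
by rewrite -!comp_assoc slide_dualm.
Qed.

(** Nested cups and caps exhibit D^* B^* as another dual of B ⊗ D.  The next
   lemmas compare it with the chosen dual, so that traces over B ⊗ D can be
   computed with the nested ones. *)
Definition ncoev B D X : hom X (B ⊗ (D ⊗ (dual D ⊗ (dual B ⊗ X)))) :=
  (B ◁ coevL D (dual B ⊗ X)) ∘ coevL B X.

Definition nevr B D X : hom (B ⊗ (D ⊗ (dual D ⊗ (dual B ⊗ X)))) X :=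
  evr B X ∘ (B ◁ evr D (dual B ⊗ X)).

Definition dual_tens B D X : hom (dual (B ⊗ D) ⊗ X) (dual D ⊗ (dual B ⊗ X)) :=
  transp (assocV B D _ ∘ ncoev B D X).

Lemma dual_tens_coev B D X :
  ((B ⊗ D) ◁ dual_tens B D X) ∘ coevL (B ⊗ D) X = assocV B D _ ∘ ncoev B D X.
Proof. exact: transpK. Qed.

Lemma dual_tens_evL B D X :
  evL D X ∘ (dual D ◁ (evL B (D ⊗ X) ∘ (dual B ◁ assoc B D X)))
    ∘ dual_tens B D ((B ⊗ D) ⊗ X) = evL (B ⊗ D) X.
Proof.
rewrite /dual_tens transp_nat transpE.
suff -> : ((B ⊗ D) ◁ (evL D X ∘ (dual D ◁ (evL B (D ⊗ X) ∘ (dual B ◁ assoc B D X)))))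
    ∘ (assocV B D _ ∘ ncoev B D ((B ⊗ D) ⊗ X)) = idm _.
  by rewrite tensm_id comp_idr.
apply: (iso_monic (assoc_iso B D X)).
rewrite ?comp_assoc assoc_nat3 comp_idr (comp_tail (assocVK _ _ _)) comp_idr.
rewrite /ncoev !lwcomp !comp_assoc.
rewrite (comp_tail (lw_eq _ (esym (coevL_nat _ _)))) !comp_assoc.
rewrite (comp_tail (lw_eq _ (esym (coevL_nat _ _)))) !comp_assoc.
rewrite (comp_tail (esym (coevL_nat _ _))) !comp_assoc.
rewrite -(lwcomp B (D ◁ evL D X)) zigzagL1 tensm_id comp_idl.
by rewrite zigzagL1 comp_idl.
Qed.

Lemma slide_dual_tens B D S X :
  (dual D ◁ br S (dual B) X) ∘ br S (dual D) (dual B ⊗ X)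
      ∘ (S ◁ dual_tens B D X)
    = dual_tens B D (S ⊗ X) ∘ br S (dual (B ⊗ D)) X.
Proof.
rewrite /dual_tens slide_transp !comp_assoc transp_nat; congr (transp _ ∘ _).
apply: (iso_monic (assoc_iso B D _)).
rewrite !comp_assoc. rewrite assocVK comp_idl assoc_nat3.
rewrite !lwcomp !comp_assoc (comp_tail (br_tens_r _ _ _ _)) !comp_assoc.
rewrite (comp_tail (lw_idm _ (assocVK _ _ _))) comp_idr.
rewrite (comp_tail (br_nat3 _ _ _)) !comp_assoc.
rewrite (comp_tail3 (lw_eq3 _ (slide_coev _ _ _))).
rewrite (lw_eq _ (esym (coevL_nat _ _))).
by rewrite -!comp_assoc [_ ∘ (_ ∘ (S ◁ _))]comp_assoc slide_coev.
Qed.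

Lemma br2_assoc A B X :
  assoc A B X ∘ ((braid B A ∘ braid A B) ▷ X) = br B A X ∘ br A B X ∘ assoc A B X.
Proof. by rewrite rwcomp comp_assoc -br_assoc (comp_tail (br_assoc _ _ _)) comp_assoc. Qed.

Lemma twist_assoc B D V :
  assoc B D V ∘ (twist (B ⊗ D) ▷ V)
    = br D B V ∘ br B D V ∘ (twist B ▷ (D ⊗ V)) ∘ (B ◁ twist D ▷ V)
        ∘ assoc B D V.
Proof.
rewrite balancing rwcomp comp_assoc br2_assoc.
have -> : twist B ⊠ twist D = (twist B ▷ D) ∘ (B ◁ twist D).
  by rewrite -tensm_comp comp_idl comp_idr.
rewrite rwcomp !comp_assoc (comp_tail (assoc_nat1 _ _ _)) !comp_assoc.
by rewrite (comp_tail (assoc_nat2 _ _ _)) !comp_assoc.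
Qed.

(** The string diagram behind the multiplicativity of the twisted evaluation.
   The left-hand side closes B ⊗ D after a full twist of B around D; two
   Yang-Baxter moves take the strand D out of the cap of B, and a third one
   makes B slide off the cap of D. *)
Lemma nested_caps B D X :
  evL D X
    ∘ (dual D ◁ (evL B (D ⊗ X) ∘ br B (dual B) (D ⊗ X) ∘ (B ◁ br D (dual B) X)))
    ∘ br B (dual D) (D ⊗ (dual B ⊗ X)) ∘ (B ◁ br D (dual D) (dual B ⊗ X))
    ∘ br D B (dual D ⊗ (dual B ⊗ X)) ∘ br B D (dual D ⊗ (dual B ⊗ X))
  = evL B X ∘ br B (dual B) X
      ∘ (B ◁ (evL D (dual B ⊗ X) ∘ br D (dual D) (dual B ⊗ X))).
Proof.
set Y := dual B ⊗ X.
set cap := evL B X ∘ br B (dual B) X.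
have passD : evL B (D ⊗ X) ∘ br B (dual B) (D ⊗ X) ∘ (B ◁ br D (dual B) X)
    ∘ br D B Y = D ◁ cap.
  rewrite (comp_tail3 (esym (yang_baxter D B (dual B) X))) !comp_assoc slide_ev_r.
  by rewrite -lwcomp.
rewrite (comp_tail3 (esym (yang_baxter D B (dual D) Y))) !comp_assoc.
rewrite -(comp_assoc (evL D X)) -lwcomp passD evL_nat.
rewrite (comp_tail3 (esym (yang_baxter B D (dual D) Y))) !comp_assoc.
by rewrite (comp_tail3 (slide_ev_r D B Y)) lwcomp comp_assoc.
Qed.

Lemma dual_tens_evr B D X :
  evr (B ⊗ D) X = nevr B D X ∘ assoc B D _ ∘ ((B ⊗ D) ◁ dual_tens B D X).
Proof.
rewrite evrE -dual_tens_evL -[_ ∘ br _ _ _]comp_assoc -slide_dual_tens.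
rewrite !comp_assoc (comp_tail (interchange _ _)) !comp_assoc.
congr (_ ∘ _).
rewrite -(comp_assoc (evL D X)) -lwcomp -(comp_assoc (evL B _)) br_tens_l.
rewrite !comp_assoc lwcomp !comp_assoc.
rewrite (comp_tail (br_tens_l _ _ _ _)) !comp_assoc.
rewrite (comp_tail (twist_assoc _ _ _)) !comp_assoc nested_caps.
congr (_ ∘ _); rewrite /nevr !evrE !lwcomp !comp_assoc.
rewrite (comp_tail (interchange _ _)) !comp_assoc.
by rewrite (comp_tail (interchange _ _)) !comp_assoc.
Qed.

Definition trL A (f : hom A A) X : hom X X :=
  evr A X ∘ (f ▷ (dual A ⊗ X)) ∘ coevL A X.

Lemma trL_qtrace A (f : hom A A) X :
  trL f X = lunit X ∘ (qtrace f ▷ X) ∘ lunitV X.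
Proof.
rewrite /trL /qtrace evrE evLE coevLE brE !rwcomp !comp_assoc.
rewrite !(comp_tail (assocK _ _ _)) !comp_idr.
rewrite !(comp_tail (esym (assoc_nat1 _ _ _))) !comp_assoc.
rewrite (comp_tail (esym (assoc_nat1 _ _ _))) !comp_assoc.
by rewrite (comp_tail (assocK _ _ _)) comp_idr.
Qed.

Lemma trLC A B (f : hom A B) (g : hom B A) X : trL (g ∘ f) X = trL (f ∘ g) X.
Proof.
rewrite /trL !rwcomp !comp_assoc (comp_tail (dualm_coev _ _)) !comp_assoc.
by rewrite (comp_tail (esym (interchange _ _))) !comp_assoc -dualm_evr.
Qed.

Definition monodromy A B : hom (A ⊗ B) (A ⊗ B) := braid B A ∘ braid A B.

Lemma trL_tens A B (f : hom (A ⊗ B) (A ⊗ B)) X :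
  trL f X = nevr A B X ∘ (assoc A B _ ∘ (f ▷ _) ∘ assocV A B _) ∘ ncoev A B X.
Proof.
rewrite /trL dual_tens_evr (comp_tail (interchange _ _)).
by rewrite -!comp_assoc dual_tens_coev.
Qed.

(** A loop coloured B, carrying f, drawn around the strand A. *)
Definition loop A B (f : hom B B) X : hom (A ⊗ X) (A ⊗ X) :=
  (A ◁ evr B X) ∘ (A ◁ f ▷ (dual B ⊗ X)) ∘ br B A (dual B ⊗ X)
    ∘ br A B (dual B ⊗ X) ∘ (A ◁ coevL B X).

Lemma loopC A B D (f : hom B D) (g : hom D B) X :
  loop A (g ∘ f) X = loop A (f ∘ g) X.
Proof.
rewrite /loop !rwcomp !lwcomp !comp_assoc.
rewrite (comp_tail (esym (br_nat1 _ _ _))) !comp_assoc.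
rewrite (comp_tail (esym (br_nat2 _ _ _))) !comp_assoc.
rewrite (comp_tail (lw_eq _ (dualm_coev _ _))) !comp_assoc.
rewrite (comp_tail (br_nat3 _ _ _)) !comp_assoc.
rewrite (comp_tail (br_nat3 _ _ _)) !comp_assoc.
rewrite (comp_tail (lw_eq _ (esym (interchange _ _)))) !comp_assoc.
by rewrite (lw_eq _ (esym (dualm_evr _ _))).
Qed.

(** A loop coloured B ⊗ D is a loop D inside a loop B; the inner one is a scalar. *)
Lemma loop_tens A B D X (c : K) :
  (forall Y, loop A (idm D) Y = c *: idm (A ⊗ Y)) ->
  loop A (idm (B ⊗ D)) X = c *: loop A (idm B) X.
Proof.
move=> /(_ (dual B ⊗ X)); rewrite /loop !tensm_id !comp_idr => loopD.
rewrite dual_tens_evr !lwcomp.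
rewrite (comp_tail (esym (br_nat3 _ _ _))) !comp_assoc.
rewrite (comp_tail (esym (br_nat3 _ _ _))) !comp_assoc.
rewrite (comp_tail (lw_eq _ (dual_tens_coev _ _ _))).
rewrite (comp_tail (br_tens_l _ _ _ _)) !comp_assoc.
rewrite (comp_tail (br_tens_r _ _ _ _)) !comp_assoc.
rewrite (comp_tail (lw_idm _ (assocVK _ _ _))) comp_idr.
rewrite /ncoev lwcomp !comp_assoc.
rewrite (comp_tail (br_nat3 _ _ (coevL D _))) !comp_assoc.
rewrite (comp_tail (esym (br_nat3 _ _ (evr D _)))) !comp_assoc.
have := congr1 (fun f => B ◁ f) loopD.
rewrite /= !lwcomp tensm_scaler tensm_id => loopBD.
rewrite (comp_tail4 loopBD) comp_scaler !comp_scalel comp_idr.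
by [].
Qed.

(** The loop does not touch its spectator X.  This is what makes it a scalar when
   A is simple. *)
Lemma loop_morphism A B : exists e : hom A A, forall X, loop A (idm B) X = e ▷ X.
Proof.
have [ev' evr'] : exists ev' : hom (B ⊗ dual B) (unit_obj C),
    forall X, evr B X = lunit X ∘ (ev' ▷ X) ∘ assocV B (dual B) X.
  exists (ev B ∘ braid B (dual B) ∘ (twist B ▷ dual B)) => X.
  rewrite evrE evLE brE !rwcomp !comp_assoc (comp_tail (assocK _ _ _)) comp_idr.
  by rewrite (comp_tail (assocV_nat1 _ _ _)) !comp_assoc.
have [runitV [_ runitVK]] := runit_iso A.
exists (runit A ∘ (A ◁ ev') ∘ assoc A B (dual B) ∘ (monodromy A B ▷ dual B)
    ∘ assocV A B (dual B) ∘ (A ◁ coev B) ∘ runitV) => X.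
have A_lunitV : A ◁ lunitV X = assoc A (unit_obj C) X ∘ (runitV ▷ X).
  apply: (iso_monic (lw_iso _ (lunit_iso X))).
  by rewrite -lwcomp lunitVK comp_assoc triangle -rwcomp runitVK !tensm_id.
rewrite /loop !tensm_id comp_idr evr' coevLE !lwcomp !comp_assoc A_lunitV.
rewrite !comp_assoc 6!rwcomp; congr (_ ∘ _).
rewrite (comp_tail (esym (assoc_nat2 _ _ _))) !comp_assoc; congr (_ ∘ _).
apply: (iso_epic (rw_iso X (assoc_iso A B (dual B)))).
rewrite [RHS](comp_tail (rw_eq X (f' := idm _) (g' := idm _) _)); last first.
  by rewrite assocK comp_idl.
rewrite -!rwcomp comp_idr.
rewrite (comp_tail3 (esym (pentagon _ _ _ _))) !comp_assoc.
rewrite comp_idr 3!rwcomp (comp_tail3 (esym (br2_assoc _ _ _))) !comp_assoc.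
rewrite (comp_tail (esym (assoc_nat1 _ _ _))) !comp_assoc.
rewrite (comp_tail (pentagon _ _ _ _)) !comp_assoc.
rewrite (comp_tail (lw_idm _ (assocK _ _ _))) comp_idr.
rewrite (comp_tail (esym (assoc_nat2 _ _ _))) !comp_assoc triangle.
by rewrite /monodromy.
Qed.

(** Closing the strand B of the double braiding leaves the loop B around A. *)
Lemma trL_monodromy A B X (c : K) :
  (forall Y, loop A (idm B) Y = c *: idm (A ⊗ Y)) ->
  trL (monodromy A B) X = c *: trL (idm A) X.
Proof.
move=> loopB; rewrite trL_tens /monodromy br2_assoc (comp_tail (assocVK _ _ _)) comp_idr.
have := loopB (dual A ⊗ X); rewrite /loop tensm_id tensm_id comp_idr => {}loopB.
rewrite /nevr /ncoev !comp_assoc (comp_tail4 loopB) comp_scaler comp_idr.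
by rewrite comp_scalel /trL tensm_id comp_idr.
Qed.

End Ribbon.

(** * Dimensions of morphism spaces in a semisimple category *)

Section VectorDimension.
Context {K : fieldType}.

Lemma dim_linear_bij (U V : vectType K) (f : {linear U -> V}) (g : V -> U) :
  cancel f g -> cancel g f -> \dim {:U} = \dim {:V}.
Proof.
move=> fK gK; have imf : limg (linfun f) = fullv.
  apply/vspaceP => v; rewrite memvf; apply/memv_imgP.
  by exists (g v); rewrite ?memvf // lfunE /= gK.
rewrite -imf limg_dim_eq //; apply/eqP; rewrite -subv0; apply/subvP => u.
rewrite memv_cap memv_ker lfunE /= => /andP[_ /eqP fu0].
by rewrite memv0 -[u]fK fu0 -[0](linear0 f) fK.
Qed.

Lemma dim_biproduct (V : vectType K) m (W : 'I_m -> vectType K)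
    (i : forall a, {linear W a -> V}) (p : forall a, {linear V -> W a}) :
  (forall a w, p a (i a w) = w) ->
  (forall a b w, a != b -> p a (i b w) = 0) ->
  (forall v, \sum_a i a (p a v) = v) ->
  \dim {:V} = (\sum_a \dim {:W a})%N.
Proof.
move=> pi pi0 ip.
have imV : (\sum_a limg (linfun (i a)))%VS = fullv.
  apply/vspaceP => v; rewrite memvf -[v]ip; apply: memv_suml => a _.
  apply: (subvP (sumv_sup a _ (subvv _))) => //.
  by apply/memv_imgP; exists (p a v); rewrite ?memvf // lfunE.
have dir : directv (\sum_a limg (linfun (i a))).
  apply/directv_sum_independent => us us_in us0 a _.
  have {us_in} [ws us_ws] : {ws : forall a, W a | forall a, us a = i a (ws a)}.
    have us' b : {w | us b = i b w}.
      by apply: cid; have /memv_imgP[w _] := us_in b isT; rewrite lfunE; exists w.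
    by exists (fun b => projT1 (us' b)) => b; case: (us' b).
  have : p a (\sum_b us b) = 0 by rewrite us0 linear0.
  rewrite linear_sum (bigD1 a) //= big1 ?addr0 => [|b ba].
    by rewrite us_ws pi => ->; rewrite linear0.
  by rewrite us_ws pi0 // eq_sym.
rewrite -imV (directvP dir) /=; apply: eq_bigr => a _.
apply: limg_dim_eq; apply/eqP; rewrite -subv0; apply/subvP => u.
rewrite memv_cap memv_ker lfunE /= => /andP[_ /eqP fu0].
by rewrite memv0 -[u](pi a) fu0 linear0.
Qed.

End VectorDimension.

Section HomDimension.
Context {K : fieldType} {C : linear_category K}.
Implicit Types A B D : C.

Definition postcomp A B D (g : hom B D) (f : hom A B) : hom A D := g ∘ f.
Definition precomp A B D (f : hom A B) (g : hom B D) : hom A D := g ∘ f.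

Fact postcomp_linear A B D (g : hom B D) : linear (@postcomp A B D g).
Proof. by move=> a f f'; rewrite /postcomp comp_linr. Qed.
HB.instance Definition _ A B D (g : hom B D) :=
  GRing.isLinear.Build K (hom A B) (hom A D) _ (@postcomp A B D g)
    (postcomp_linear g).

Fact precomp_linear A B D (f : hom A B) : linear (@precomp A B D f).
Proof. by move=> a g g'; rewrite /precomp comp_linl. Qed.
HB.instance Definition _ A B D (f : hom A B) :=
  GRing.isLinear.Build K (hom B D) (hom A D) _ (@precomp A B D f)
    (precomp_linear f).

Lemma comp_sumr A B D (I : finType) (g : hom B D) (f : I -> hom A B) :
  g ∘ (\sum_i f i) = \sum_i (g ∘ f i).
Proof. exact: (linear_sum (postcomp g)). Qed.

Lemma comp_suml A B D (I : finType) (g : I -> hom B D) (f : hom A B) :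
  (\sum_i g i) ∘ f = \sum_i (g i ∘ f).
Proof. exact: (linear_sum (precomp f)). Qed.

Lemma dim_hom_suml m (Y : 'I_m -> C) A B : is_direct_sum Y A ->
  \dim {:hom A B} = (\sum_a \dim {:hom (Y a) B})%N.
Proof.
case=> i [p [pi pi0 ip]].
apply: (@dim_biproduct _ (hom A B) m (fun a => hom (Y a) B)
  (fun a => precomp (p a)) (fun a => precomp (i a))) => /= [a w|a b w ab|v];
  rewrite /precomp.
- by rewrite -comp_assoc pi comp_idr.
- by rewrite -comp_assoc pi0 1?eq_sym // comp0r.
- under eq_bigr do rewrite -comp_assoc.
  by rewrite -comp_sumr ip comp_idr.
Qed.

Lemma dim_hom_sumr m (Y : 'I_m -> C) A B : is_direct_sum Y A ->
  \dim {:hom B A} = (\sum_a \dim {:hom B (Y a)})%N.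
Proof.
case=> i [p [pi pi0 ip]].
apply: (@dim_biproduct _ (hom B A) m (fun a => hom B (Y a))
  (fun a => postcomp (i a)) (fun a => postcomp (p a))) => /= [a w|a b w ab|v];
  rewrite /postcomp.
- by rewrite comp_assoc pi comp_idl.
- by rewrite comp_assoc pi0 // comp0l.
- under eq_bigr do rewrite comp_assoc.
  by rewrite -comp_suml ip comp_idl.
Qed.

Lemma iso_trans A B D : isomorphic A B -> isomorphic B D -> isomorphic A D.
Proof.
case=> f [g [gf fg]] [f' [g' [gf' fg']]]; exists (f' ∘ f), (g ∘ g').
split; rewrite -!comp_assoc.
  by rewrite [g' ∘ _]comp_assoc gf' comp_idl.
by rewrite [f ∘ _]comp_assoc fg comp_idl.
Qed.

Lemma direct_sum_iso m (Y Y' : 'I_m -> C) A : is_direct_sum Y A ->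
  (forall a, isomorphic (Y a) (Y' a)) -> is_direct_sum Y' A.
Proof.
case=> i [p [pi pi0 ip]] YY'.
have fg a : {fg : hom (Y a) (Y' a) * hom (Y' a) (Y a) |
    fg.2 ∘ fg.1 = idm _ /\ fg.1 ∘ fg.2 = idm _}.
  by apply: cid; have [f [g fg]] := YY' a; exists (f, g).
exists (fun a => i a ∘ (projT1 (fg a)).2), (fun a => (projT1 (fg a)).1 ∘ p a).
split=> [a|a b ab|].
- case: (fg a) => -[f g] /= [gf fg'].
  by rewrite !comp_assoc (comp_tail (pi a)) comp_idr.
- by rewrite !comp_assoc (comp_tail (pi0 _ _ ab)) comp0r comp0l.
- rewrite -[RHS]ip; apply: eq_bigr => a _; case: (fg a) => -[f g] /= [gf fg'].
  by rewrite !comp_assoc (comp_tail gf) comp_idr.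
Qed.

Lemma direct_sum1 A B : isomorphic A B -> is_direct_sum (fun _ : 'I_1 => A) B.
Proof.
case=> f [g [gf fg]]; exists (fun _ => f), (fun _ => g).
by split=> // [a b|]; rewrite ?big_ord1 // !ord1.
Qed.

Lemma dim_hom_isol A A' B : isomorphic A A' -> \dim {:hom A B} = \dim {:hom A' B}.
Proof. by move/direct_sum1/dim_hom_suml => ->; rewrite big_ord1. Qed.

Lemma kernel_mono A B D (f : hom A B) (k : hom D A) :
  is_kernel f k -> is_mono k.
Proof.
case=> fk kuniv Z g h kgh.
have [|u [_ uniq]] := kuniv Z (k ∘ g); first by rewrite comp_assoc fk comp0l.
by rewrite -(uniq g) // (uniq h).
Qed.

Lemma iso_zero A B (f : hom A B) : is_iso f -> f = 0 -> idm A = 0.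
Proof. by case=> g [<- _] ->; rewrite comp0r. Qed.

Hypothesis abC : abelian_category C.

Lemma simple_zero_or_mono A B (f : hom A B) :
  simple_object A -> f = 0 \/ is_mono f.
Proof.
move=> [_ Amono]; have [D [k kf]] := kernels abC f.
have [k0|[k' [kk' k'k]]] := Amono D k (kernel_mono kf); [right|left].
  case: kf => fk kuniv Z g h fgh.
  have [|u [ku _]] := kuniv Z (g - h).
    by rewrite (comp_addr f g (- h)) -scaleN1r comp_scaler scaleN1r fgh subrr.
  by apply/eqP; rewrite -subr_eq0 -ku k0 comp0l.
by rewrite -[f]comp_idr -k'k comp_assoc (proj1 kf) comp0l.
Qed.

Lemma schur A B (f : hom A B) :
  simple_object A -> simple_object B -> f = 0 \/ is_iso f.
Proof.
by move=> sA sB; have [|/(proj2 sB)] := simple_zero_or_mono f sA; [left|].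
Qed.

End HomDimension.

Import passmx.

Section Schur.
Context {K : closedFieldType} {C : linear_category K}.
Implicit Types A B D : C.
Hypothesis abC : abelian_category C.

(** The field is algebraically closed: composition with f has an eigenvector g, so
   that f minus the eigenvalue is not mono, hence zero. *)
Lemma schur_end A (f : hom A A) : simple_object A -> exists a, f = a *: idm A.
Proof.
move=> sA; have [A0 _] := sA.
pose e := vbasis {:hom A A}; have e_basis : basis_of {:hom A A} e := vbasisP _.
pose M := mxof e e (linfun (postcomp f)).
have dim0 : \dim {:hom A A} != 0%N.
  rewrite dimv_eq0; apply: contra_neq A0 => full0.
  by apply/eqP; rewrite -memv0 -full0 memvf.
have [a Ma] : exists a, root (char_poly M) a.
  by apply/closed_rootP; rewrite size_char_poly eqSS.
move: Ma; rewrite -eigenvalue_root_char => /eigenvalueP[v vM v0].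
exists a; apply/eqP; rewrite -subr_eq0; apply/eqP.
have [//|fa_iso] := schur abC (f - a *: idm A) sA sA.
suff : vecof e v = 0 by move/eqP; rewrite vecof_eq0 // (negPf v0).
apply: (iso_monic fa_iso); rewrite comp0r comp_addl -scaleNr comp_scalel comp_idl.
have := hom_vecof e e_basis (linfun (postcomp f)) v.
rewrite lfunE /= /postcomp => ->; rewrite -/M vM.
by rewrite linearZ /= -scalerDl subrr scale0r.
Qed.

Lemma scalar_ofP A (f : hom A A) : simple_object A -> f = scalar_of f *: idm A.
Proof.
move=> sA; have [a fa] := schur_end f sA.
exact: (xgetPex 0 (ex_intro (fun b : K => f = b *: idm A) a fa)).
Qed.

Lemma scalar_of_scale A (a : K) : simple_object A -> scalar_of (a *: idm A) = a.
Proof.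
move=> sA; have := scalar_ofP (a *: idm A) sA; set b := scalar_of _ => e.
apply/eqP; rewrite -subr_eq0; apply/eqP.
have := congr1 (fun f => f - b *: idm A) e; rewrite subrr -scalerBl => /eqP.
rewrite scaler_eq0 (negPf (proj1 sA)) orbF => /eqP ab.
by rewrite -opprB ab oppr0.
Qed.

Lemma dim_simple_end A : simple_object A -> \dim {:hom A A} = 1%N.
Proof.
move=> sA; suff -> : {:hom A A}%VS = <[idm A]>%VS.
  by rewrite dim_vline (proj1 sA).
apply/vspaceP => f; rewrite memvf; apply/esym/vlineP.
by exists (scalar_of f); exact: scalar_ofP.
Qed.

Lemma dim_simple_hom0 A B : simple_object A -> simple_object B ->
  ~ isomorphic A B -> \dim {:hom A B} = 0%N.
Proof.
move=> sA sB AB; apply/eqP; rewrite dimv_eq0; apply/eqP/vspaceP => f.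
rewrite memvf memv0; have [->|f_iso] := schur abC f sA sB; first by rewrite eqxx.
by case: AB; exists f.
Qed.

End Schur.

Section Multiplicity.
Context {K : closedFieldType} {C : linear_category K}.
Implicit Types A B D : C.
Hypothesis ssC : semisimple_category C.
Variables (n : nat) (X : 'I_n -> C).
Hypothesis Xreps : simple_representatives X.

Let abC : abelian_category C. Proof. by case: ssC. Qed.
Let simpleX i : simple_object (X i). Proof. by case: Xreps. Qed.

Lemma dim_hom_reps i j : \dim {:hom (X i) (X j)} = (i == j).
Proof.
have [<-|ij] := eqVneq; first exact: dim_simple_end.
apply: dim_simple_hom0 => // iso; case: Xreps => _ /(_ _ _ iso) ji _.
by rewrite ji eqxx in ij.
Qed.

Lemma reps_decomposition A :
  exists m (y : 'I_m -> 'I_n), is_direct_sum (fun a => X (y a)) A.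
Proof.
have [_ /(_ A)[m [Y [simpleY YA]]]] := ssC; case: Xreps => _ _ /(_ (Y _)) Xy.
have y a : {i | isomorphic (Y a) (X i)} by apply: cid; exact: Xy.
by exists m, (fun a => projT1 (y a)); apply: direct_sum_iso YA _ => a; case: (y a).
Qed.

Definition mult A k : nat := \dim {:hom A (X k)}.

(** Additive invariants of A depend on the multiplicities only. *)
Lemma sum_decomposition A m (y : 'I_m -> 'I_n) (V : nmodType) (F : 'I_n -> V) :
  is_direct_sum (fun a => X (y a)) A ->
  \sum_a F (y a) = \sum_k F k *+ mult A k.
Proof.
move=> yA; rewrite (partition_big y predT) //=; apply: eq_bigr => k _.
rewrite /mult (dim_hom_suml _ yA).
rewrite (eq_bigr (fun=> F k)) => [|a /eqP-> //]; rewrite sumr_const; congr (_ *+ _).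
by rewrite -sum1_card big_mkcond; apply: eq_bigr => a _; rewrite dim_hom_reps.
Qed.

Lemma dim_hom_sym A k : \dim {:hom (X k) A} = mult A k.
Proof.
have [m [y yA]] := reps_decomposition A.
rewrite /mult (dim_hom_suml _ yA) (dim_hom_sumr _ yA).
by apply: eq_bigr => a _; rewrite !dim_hom_reps eq_sym.
Qed.

End Multiplicity.

(** * The characters of the fusion ring *)

Section TensorDimension.
Context {K : closedFieldType} {C : ribbon_category K}.
Implicit Types A B D E : C.
Local Notation "A ◁ g" := (idm A ⊠ g) (at level 35, right associativity).
Local Notation "f ▷ X" := (f ⊠ idm X) (at level 35, right associativity).

Lemma tensm_sumr A A' B B' (I : finType) (f : hom A A') (g : I -> hom B B') :
  f ⊠ (\sum_i g i) = \sum_i (f ⊠ g i).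
Proof.
by rewrite (big_morph (fun h => f ⊠ h) (tensm_addr f) (tensm0r _ _ f)).
Qed.

Lemma tensm_suml A A' B B' (I : finType) (f : I -> hom A A') (g : hom B B') :
  (\sum_i f i) ⊠ g = \sum_i (f i ⊠ g).
Proof.
rewrite (big_morph (fun h => h ⊠ g) (fun f f' => tensm_addl f f' g) (tensm0l _ _ g)).
by [].
Qed.

Lemma direct_sum_tensl m (Y : 'I_m -> C) A B :
  is_direct_sum Y A -> is_direct_sum (fun a => Y a ⊗ B) (A ⊗ B).
Proof.
case=> i [p [pi pi0 ip]].
exists (fun a => i a ▷ B), (fun a => p a ▷ B); split=> [a|a b ab|].
- by rewrite -rwcomp pi tensm_id.
- by rewrite -rwcomp pi0 // tensm0l.
- by under eq_bigr do rewrite -rwcomp; rewrite -tensm_suml ip tensm_id.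
Qed.

Lemma direct_sum_tensr m (Y : 'I_m -> C) A B :
  is_direct_sum Y A -> is_direct_sum (fun a => B ⊗ Y a) (B ⊗ A).
Proof.
case=> i [p [pi pi0 ip]].
exists (fun a => B ◁ i a), (fun a => B ◁ p a); split=> [a|a b ab|].
- by rewrite -lwcomp pi tensm_id.
- by rewrite -lwcomp pi0 // tensm0r.
- by under eq_bigr do rewrite -lwcomp; rewrite -tensm_sumr ip tensm_id.
Qed.

Lemma iso_tensl A A' B : isomorphic A A' -> isomorphic (A ⊗ B) (A' ⊗ B).
Proof. by case=> f f_iso; exists (f ▷ B); apply: rw_iso. Qed.

Fact transp_linear A V X : linear (@transp K C A V X).
Proof. by move=> a g g'; rewrite !transpE tensm_linr comp_linr. Qed.
HB.instance Definition _ A V X :=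
  GRing.isLinear.Build K (hom X (A ⊗ V)) (hom (dual A ⊗ X) V) _
    (@transp K C A V X) (@transp_linear A V X).

Lemma dim_hom_dual A B D : \dim {:hom (dual A ⊗ B) D} = \dim {:hom B (A ⊗ D)}.
Proof.
apply/esym/(dim_linear_bij (f := @transp K C A D B)
  (g := fun h => (A ◁ h) ∘ coevL A B)) => h.
  exact: transpK.
by rewrite /= transpE lwcomp comp_assoc evL_nat -comp_assoc zigzagL2 comp_idr.
Qed.

(** The ribbon axiom says that the twist of the dual acts on coev as t does;
   the second zigzag recovers an endomorphism of the dual from its action on
   coev. *)
Lemma twist_dual A (t : K) : twist A = t *: idm A -> twist (dual A) = t *: idm _.
Proof.
move=> twA; apply: rw1_inj; set I := unit_obj _.
have twist_coevL : (A ◁ twist (dual A) ▷ I) ∘ coevL A I = t *: coevL A I.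
  rewrite coevLE !comp_assoc -assoc_nat2 -(comp_assoc (assoc _ _ _)) -rwcomp.
  rewrite -ribbon_axiom twA tensm_scalel tensm_id comp_scalel comp_idl.
  by rewrite tensm_scalel comp_scaler !comp_scalel.
rewrite -[LHS]comp_idr -(zigzagL2 A I) comp_assoc -evL_nat -comp_assoc -lwcomp.
by rewrite twist_coevL tensm_scaler comp_scaler zigzagL2 tensm_scalel tensm_id.
Qed.

(** The braiding of the unit with itself is trivial, so the balancing axiom makes
   the scalar of the twist idempotent. *)
Lemma twist_unit : simple_object (unit_obj C) -> abelian_category C ->
  twist (unit_obj C) = idm _.
Proof.
move=> sI abC; set I := unit_obj C.
have [t twI] := schur_end abC (twist I) sI.
have braidI : braid I I = idm _.
  apply: (iso_monic (lunit_iso _)).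
  by rewrite lunit_braid -lunit1 comp_idr.
have twII : twist (I ⊗ I) = t *: idm _.
  apply: (iso_monic (lunit_iso _)).
  by rewrite -twist_nat twI comp_scalel comp_idl comp_scaler comp_idr.
have := balancing I I; rewrite braidI !comp_idl twII twI.
rewrite tensm_scalel tensm_scaler tensm_id scalerA => /eqP.
rewrite -subr_eq0 -scalerBl scaler_eq0 => /orP[|/eqP II0].
  rewrite -{1}[t]mulr1 -mulrBr mulf_eq0 subr_eq0 => /orP[/eqP t0|/eqP<-].
    have := iso_zero (twist_iso I); rewrite twI t0 scale0r => /(_ erefl) I0.
    by have := proj1 sI; rewrite I0 eqxx.
  by rewrite scale1r.
suff I0 : idm I = 0 by have := proj1 sI; rewrite -/I I0 eqxx.
by apply: (iso_epic (lunit_iso I)); rewrite comp0l -[LHS]comp_idr II0 comp0r.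
Qed.

End TensorDimension.

Section Traces.
Context {K : closedFieldType} {C : ribbon_category K}.
Implicit Types A B D E Y : C.
Hypothesis ssC : semisimple_category C.
Hypothesis simple1 : simple_object (unit_obj C).
Variables (n : nat) (X : 'I_n -> C).
Hypothesis Xreps : simple_representatives X.
Local Notation "A ◁ g" := (idm A ⊠ g) (at level 35, right associativity).
Local Notation "f ▷ X" := (f ⊠ idm X) (at level 35, right associativity).
Let abC : abelian_category C. Proof. by case: ssC. Qed.
Let simpleX i : simple_object (X i). Proof. by case: Xreps. Qed.

Definition qtr A (f : hom A A) : K := scalar_of (qtrace f).

Lemma trLE A (f : hom A A) Y : trL f Y = qtr f *: idm Y.
Proof.
rewrite trL_qtrace (scalar_ofP abC (qtrace f) simple1) -/(qtr f).
by rewrite tensm_scalel tensm_id comp_scaler comp_scalel comp_idr lunitVK.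
Qed.

Lemma unit_scalar_inj (a b : K) :
  a *: idm (unit_obj C) = b *: idm (unit_obj C) -> a = b.
Proof.
move/eqP; rewrite -subr_eq0 -scalerBl scaler_eq0 (negPf (proj1 simple1)) orbF.
by rewrite subr_eq0 => /eqP.
Qed.

Lemma qtrC A B (f : hom A B) (g : hom B A) : qtr (g ∘ f) = qtr (f ∘ g).
Proof. by apply: unit_scalar_inj; rewrite -!trLE trLC. Qed.

Lemma qtrD A (f g : hom A A) : qtr (f + g) = qtr f + qtr g.
Proof.
apply: unit_scalar_inj; rewrite scalerDl -!trLE /trL.
by rewrite tensm_addl comp_addr comp_addl.
Qed.

Lemma qtrZ A a (f : hom A A) : qtr (a *: f) = a * qtr f.
Proof.
apply: unit_scalar_inj; rewrite -scalerA -!trLE /trL.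
by rewrite tensm_scalel comp_scaler comp_scalel.
Qed.

Lemma qtr_sum A (I : finType) (f : I -> hom A A) :
  qtr (\sum_i f i) = \sum_i qtr (f i).
Proof.
apply: big_morph; first exact: qtrD.
by have := qtrZ 0 (0 : hom A A); rewrite scale0r mul0r.
Qed.

Local Notation d := (fun k => qdim (X k)).
Local Notation th := (theta X).

Lemma twistX i : twist (X i) = th i *: idm (X i).
Proof. exact: (scalar_ofP abC). Qed.

Lemma qtr_twist A : qtr (twist A) = \sum_k (d k * th k) *+ mult X A k.
Proof.
have [m [y yA]] := reps_decomposition ssC Xreps A.
rewrite -(sum_decomposition ssC Xreps (fun k => d k * th k) yA).
case: yA => i [p [pi _ ip]].
rewrite -[twist A]comp_idr -ip comp_sumr qtr_sum; apply: eq_bigr => a _.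
rewrite comp_assoc twist_nat -comp_assoc qtrC -comp_assoc pi comp_idr twistX.
by rewrite qtrZ mulrC.
Qed.

Lemma loopD A B (f g : hom B B) Y : loop A (f + g) Y = loop A f Y + loop A g Y.
Proof. by rewrite /loop tensm_addl tensm_addr comp_addr !comp_addl. Qed.

Lemma loop_sum A B (I : finType) (f : I -> hom B B) Y :
  loop A (\sum_i f i) Y = \sum_i loop A (f i) Y.
Proof.
apply: (big_morph (fun f => loop A f Y)) => [f' g'|]; first exact: loopD.
by rewrite /loop tensm0l tensm0r comp0r !comp0l.
Qed.

Lemma loop_simple i B : exists c, forall Y, loop (X i) (idm B) Y = c *: idm (X i ⊗ Y).
Proof.
have [e loop_e] := loop_morphism (X i) B; have [c ec] := schur_end abC e (simpleX i).
by exists c => Y; rewrite loop_e ec tensm_scalel tensm_id.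
Qed.

Definition chi i j : K := projT1 (cid (loop_simple i (X j))).

Lemma loop_chi i j Y : loop (X i) (idm (X j)) Y = chi i j *: idm (X i ⊗ Y).
Proof. by rewrite /chi; case: cid. Qed.

Lemma loop_mult i B Y :
  loop (X i) (idm B) Y = (\sum_k chi i k *+ mult X B k) *: idm (X i ⊗ Y).
Proof.
have [m [y yB]] := reps_decomposition ssC Xreps B.
rewrite -(sum_decomposition ssC Xreps (chi i) yB).
case: yB => j [p [pj _ jp]].
rewrite -jp loop_sum scaler_suml; apply: eq_bigr => a _.
by rewrite loopC pj loop_chi.
Qed.

Lemma simple_tens1 A : simple_object A -> idm (A ⊗ unit_obj C) != 0.
Proof.
case=> A0 _; apply: contra_neq A0 => AI0.
by apply: (iso_epic (runit_iso A)); rewrite comp0l -[LHS]comp_idr AI0 comp0r.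
Qed.

Lemma simple_scalar_inj i (a b : K) :
  (forall Y, a *: idm (X i ⊗ Y) = b *: idm (X i ⊗ Y)) -> a = b.
Proof.
move/(_ (unit_obj C))/eqP; rewrite -subr_eq0 -scalerBl scaler_eq0.
by rewrite (negPf (simple_tens1 (simpleX i))) orbF subr_eq0 => /eqP.
Qed.

Lemma chiM i j k : chi i j * chi i k = \sum_m (fusion X j k m)%:R * chi i m.
Proof.
apply: (simple_scalar_inj (i := i)) => Y; rewrite mulrC -scalerA -loop_chi.
rewrite -(@loop_tens _ _ (X i) _ (X k)) => [|Z]; last exact: loop_chi.
rewrite loop_mult; congr (_ *: _); apply: eq_bigr => m _.
by rewrite mulr_natl.
Qed.

(** Both sides are the trace of the twist of X i ⊗ X j: on the left through its
   decomposition, on the right through the balancing axiom and [trL_monodromy]. *)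
Lemma balancing_chi i j :
  \sum_k (fusion X i j k)%:R * d k * th k = th i * th j * d i * chi i j.
Proof.
transitivity (qtr (twist (X i ⊗ X j))).
  by rewrite qtr_twist; apply: eq_bigr => k _; rewrite -mulrA mulr_natl.
rewrite balancing !twistX tensm_scalel tensm_scaler tensm_id !comp_scaler comp_idr.
rewrite !qtrZ mulrA -!mulrA; congr (_ * (_ * _)).
apply: unit_scalar_inj; rewrite -trLE -/(monodromy _ _).
rewrite (trL_monodromy _ (c := chi i j)) => [|Y]; last exact: loop_chi.
by rewrite trLE scalerA mulrC.
Qed.

Lemma loop_nat A A' B Y (h : hom A A') :
  loop A' (idm B) Y ∘ (h ▷ Y) = (h ▷ Y) ∘ loop A (idm B) Y.
Proof.
rewrite /loop !tensm_id !comp_idr !comp_assoc (comp_tail (interchange _ _)) !comp_assoc.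
rewrite (comp_tail (br_nat1 _ _ _)) !comp_assoc (comp_tail (br_nat2 _ _ _)) !comp_assoc.
by rewrite interchange.
Qed.

Lemma loop_unit B Y : loop (unit_obj C) (idm B) Y = qdim B *: idm _.
Proof.
apply: (iso_monic (lunit_iso _)).
rewrite /loop tensm_id tensm_id comp_idr !comp_assoc lunit_nat.
rewrite (comp_tail (br_unit_r _ _)) (comp_tail (br_unit_l _ _)).
rewrite (comp_tail (lunit_nat _)) comp_assoc.
have := trLE (idm B) Y; rewrite /trL tensm_id comp_idr => ->.
by rewrite comp_scalel comp_idl comp_scaler comp_idr.
Qed.

Variable o : 'I_n.
Hypothesis Xo : isomorphic (X o) (unit_obj C).

(** A loop around the unit object is not linked with anything. *)
Lemma chi_unit j : chi o j = qdim (X j).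
Proof.
case: Xo => h h_iso; apply: (simple_scalar_inj (i := o)) => Y.
apply: (iso_monic (rw_iso Y h_iso)); rewrite -loop_chi -loop_nat loop_unit.
by rewrite comp_scalel comp_scaler comp_idl comp_idr.
Qed.

Lemma theta_iso A i (t : K) :
  isomorphic (X i) A -> twist A = t *: idm A -> th i = t.
Proof.
case=> f f_iso twA; rewrite -[RHS](scalar_of_scale abC _ (simpleX i)).
congr (scalar_of _); apply: (iso_monic f_iso).
by rewrite -twist_nat twA comp_scalel comp_scaler comp_idl comp_idr.
Qed.

Lemma theta_unit : th o = 1.
Proof. by apply: theta_iso Xo _; rewrite twist_unit // scale1r. Qed.

Lemma theta_neq0 i : th i != 0.
Proof.
apply/eqP => th0; have := iso_zero (twist_iso (X i)).
by rewrite twistX th0 scale0r => /(_ erefl)/eqP; rewrite (negPf (proj1 (simpleX i))).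
Qed.

Lemma theta_dual i j : isomorphic (X i) (dual (X j)) -> th i = th j.
Proof. by move=> ij; apply: theta_iso ij _; apply: twist_dual; exact: twistX. Qed.

Lemma fusion_dualE i j k : fusion_dual X i j k = fusion X i k j.
Proof. by rewrite /fusion_dual dim_hom_dual (dim_hom_sym ssC Xreps). Qed.

Lemma fusion_star i i' j k : isomorphic (X i') (dual (X i)) ->
  fusion X i' j k = fusion X i k j.
Proof.
by move=> ii'; rewrite -[RHS]fusion_dualE; apply: dim_hom_isol; exact: iso_tensl.
Qed.

Lemma fusionC i j k : fusion X i j k = fusion X j i k.
Proof. by apply: dim_hom_isol; exists (braid _ _); exact: braid_iso. Qed.

Lemma fusion_unit j k : fusion X o j k = (j == k).
Proof.
rewrite -(dim_hom_reps ssC Xreps); apply: dim_hom_isol.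
by apply: iso_trans (iso_tensl _ Xo) _; exists (lunit _); exact: lunit_iso.
Qed.

Lemma fusionA i j k l :
  (\sum_m fusion X i j m * fusion X m k l = \sum_m fusion X j k m * fusion X i m l)%N.
Proof.
transitivity (\dim {:hom ((X i ⊗ X j) ⊗ X k) (X l)}).
  have [m [y yij]] := reps_decomposition ssC Xreps (X i ⊗ X j).
  rewrite (dim_hom_suml _ (direct_sum_tensl _ yij)).
  rewrite (sum_decomposition ssC Xreps (fun a => fusion X a k l) yij).
  by apply: eq_bigr => a _; rewrite -mulr_natr natn mulnC.
have -> : \dim {:hom ((X i ⊗ X j) ⊗ X k) (X l)}
    = \dim {:hom (X i ⊗ (X j ⊗ X k)) (X l)}.
  by apply: dim_hom_isol; exists (assoc _ _ _); exact: assoc_iso.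
have [m [y yjk]] := reps_decomposition ssC Xreps (X j ⊗ X k).
rewrite (dim_hom_suml _ (direct_sum_tensr _ yjk)).
rewrite (sum_decomposition ssC Xreps (fun a => fusion X i a l) yjk).
by apply: eq_bigr => a _; rewrite -mulr_natr natn mulnC.
Qed.

End Traces.

(** * Modular data *)

(** What the categorical part provides: fusion coefficients, duality of labels,
   dimensions, twists, and characters dchi i of the fusion ring tied to them by
   [dbalancing].  The label 0 is the unit; the S-matrix is computed from these
   data ([dS]). *)
Record modular_datum (F : numClosedFieldType) n := ModularDatum {
  dfusion : 'I_n.+1 -> 'I_n.+1 -> 'I_n.+1 -> nat;
  dstar : 'I_n.+1 -> 'I_n.+1;
  ddim : 'I_n.+1 -> F;
  dtwist : 'I_n.+1 -> F;
  dchi : 'I_n.+1 -> 'I_n.+1 -> F;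
  dfusion_assoc : forall i j k l,
    (\sum_m dfusion i j m * dfusion m k l = \sum_m dfusion j k m * dfusion i m l)%N;
  dfusion_comm : forall i j k, dfusion i j k = dfusion j i k;
  dfusion_unit : forall j k, dfusion ord0 j k = (j == k);
  dfusion_star : forall i j k, dfusion (dstar i) j k = dfusion i k j;
  dstarK : involutive dstar;
  ddim_gt0 : forall i, 0 < ddim i;
  dtwist_neq0 : forall i, dtwist i != 0;
  dtwist_unit : dtwist ord0 = 1;
  dtwist_star : forall i, dtwist (dstar i) = dtwist i;
  dchiM : forall i j k, dchi i j * dchi i k = \sum_m (dfusion j k m)%:R * dchi i m;
  dchi_unit : forall j, dchi ord0 j = ddim j;
  dbalancing : forall i j, \sum_k (dfusion i j k)%:R * ddim k * dtwist k
    = dtwist i * dtwist j * ddim i * dchi i j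
}.

Section ModularDatum.
Context {F : numClosedFieldType} {n : nat} (M : modular_datum F n).
Implicit Types i j k l m : 'I_n.+1.
Local Notation N := (dfusion M).
Local Notation star := (dstar M).
Local Notation d := (ddim M).
Local Notation th := (dtwist M).
Local Notation chi := (dchi M).

Definition dS i j : F := (th i * th j)^-1 * \sum_k (N i k j)%:R * d k * th k.
Local Notation s := dS.

Lemma ddim_neq0 i : d i != 0. Proof. by rewrite gt_eqF ?ddim_gt0. Qed.

Lemma dstar_bij : bijective star.
Proof. by exists star; exact: dstarK. Qed.

Lemma dfusion_starl i j k : N i j k = N (star i) k j. Proof. by rewrite dfusion_star. Qed.

Lemma dfusion_dual i j k : N (star i) (star j) (star k) = N i j k.
Proof.
by rewrite dfusion_star dfusion_comm dfusion_star dfusion_comm dfusion_star dfusion_comm.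
Qed.

Lemma dchi1 i : chi i ord0 = 1.
Proof.
have := dbalancing M i ord0.
rewrite (bigD1 i) //= big1 => [|k ki]; last first.
  by rewrite dfusion_comm dfusion_unit eq_sym (negPf ki) !mul0r.
rewrite dfusion_comm dfusion_unit eqxx addr0 mul1r dtwist_unit mulr1 => e.
have nz : th i * d i != 0 by rewrite mulf_neq0 ?dtwist_neq0 ?ddim_neq0.
by apply: (mulfI nz); rewrite -e mulr1 mulrC.
Qed.

(** The values of a character form a common eigenvector of the fusion matrices,
   and the matrix of the dual label is the transposed one. *)
Lemma dchi_star i j : chi i (star j) = (chi i j)^*.
Proof.
pose nrm := \sum_k chi i k * (chi i k)^*.
have nrm_neq0 : nrm != 0.
  rewrite gt_eqF // /nrm (bigD1 ord0) //= dchi1 mul1r rmorph1.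
  by rewrite ltr_pwDl ?ltr01 // sumr_ge0 // => k _; rewrite mul_conjC_ge0.
have chi_nrm : chi i j * nrm = \sum_k \sum_m (N j k m)%:R * chi i m * (chi i k)^*.
  rewrite mulr_sumr; apply: eq_bigr => k _.
  by rewrite mulrA dchiM mulr_suml.
have chi_star_nrm :
    (chi i (star j))^* * nrm = \sum_k \sum_m (N j k m)%:R * chi i m * (chi i k)^*.
  rewrite mulr_sumr exchange_big /=; apply: eq_bigr => m _.
  rewrite mulrCA -rmorphM dchiM rmorph_sum mulr_sumr; apply: eq_bigr => k _.
  by rewrite rmorphM rmorph_nat dfusion_star mulrA [chi i m * _]mulrC.
by rewrite -[LHS]conjCK; congr (_^*); apply: (mulIf nrm_neq0); rewrite chi_nrm.
Qed.

Lemma ddim_real j : (d j)^* = d j.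
Proof. by rewrite conj_Creal // gtr0_real ?ddim_gt0. Qed.

Lemma ddim_star j : d (star j) = d j.
Proof. by rewrite -!dchi_unit dchi_star dchi_unit ddim_real. Qed.

Lemma ddim1 : d ord0 = 1. Proof. by rewrite -dchi_unit dchi1. Qed.

Lemma dS_chi i j : s i j = d i * chi (star i) j.
Proof.
rewrite /dS; under eq_bigr do rewrite dfusion_starl.
rewrite dbalancing dtwist_star ddim_star -mulrA mulKf //.
by rewrite mulf_neq0 ?dtwist_neq0.
Qed.

Lemma dSC i j : s i j = s j i.
Proof.
rewrite /dS [th j * _]mulrC (reindex_inj (bij_inj dstar_bij)) /=; congr (_ * _).
apply: eq_bigr => k _; rewrite ddim_star dtwist_star; congr (_%:R * _ * _).
by rewrite dfusion_comm dfusion_star dfusion_comm.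
Qed.

Lemma dS_starr i j : s i (star j) = (s i j)^*.
Proof. by rewrite !dS_chi dchi_star rmorphM /= ddim_real. Qed.

Lemma dS_starl i j : s (star i) j = (s i j)^*.
Proof. by rewrite dSC dS_starr dSC. Qed.

Lemma dstar0 : star ord0 = ord0.
Proof.
have := dfusion_star M ord0 ord0 (star ord0).
rewrite dfusion_comm !dfusion_unit eqxx; by case: eqVneq.
Qed.

Lemma dS0 j : s ord0 j = d j.
Proof. by rewrite dS_chi dstar0 ddim1 mul1r dchi_unit. Qed.

Lemma dSM i j k : s i j * s i k = d i * \sum_m (N j k m)%:R * s i m.
Proof.
rewrite !dS_chi mulrACA dchiM -mulrA; congr (_ * _).
by rewrite mulr_sumr; apply: eq_bigr => m _; rewrite dS_chi mulrCA.
Qed.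

Hypothesis S_unit : \matrix_(i, j) s i j \in unitmx.

Lemma dS_row_inj i j (a : F) : (forall k, s i k = a * s j k) -> i = j.
Proof.
move=> e; apply/eqP; apply: contraT => ij.
pose v : 'rV[F]_n.+1 := delta_mx 0 i - a *: delta_mx 0 j.
have : v *m \matrix_(i, j) s i j = 0.
  rewrite mulmxBl -scalemxAl -!rowE; apply/rowP => k.
  by rewrite !mxE e subrr.
move/(congr1 (mulmx^~ (invmx (\matrix_(i, j) s i j)))).
rewrite mul0mx mulmxK // => /rowP/(_ i); rewrite !mxE !eqxx (negPf ij).
by rewrite mulr0 subr0 => /eqP; rewrite oner_eq0.
Qed.

(** Multiplication by the dual label is adjoint to multiplication by k, so the
   pairing S of the two characters satisfies chi i k * S = chi j k * S. *)
Lemma dchi_orthogonal i j k :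
  chi i k != chi j k -> \sum_m chi i m * (chi j m)^* = 0.
Proof.
set S := \sum_m _; apply: contra_neq_eq => S0; apply: (mulIf S0).
transitivity (\sum_l \sum_m (N k l m)%:R * chi i m * (chi j l)^*).
  rewrite mulr_sumr; apply: eq_bigr => l _.
  by rewrite mulrA dchiM mulr_suml.
rewrite exchange_big mulr_sumr /=; apply: eq_bigr => m _.
rewrite mulrCA -[chi j k]conjCK -dchi_star -rmorphM dchiM rmorph_sum mulr_sumr.
by apply: eq_bigr => l _; rewrite rmorphM rmorph_nat dfusion_star mulrA [chi i m * _]mulrC.
Qed.

Lemma dS_orthogonal i j : i != j -> \sum_k s i k * (s j k)^* = 0.
Proof.
move=> ij.
have [k chi_neq] : exists k, chi (star i) k != chi (star j) k.
  apply: contra_neqP ij => chi_eq; apply: (@dS_row_inj _ _ (d i / d j)) => k.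
  have -> : s i k = d i * chi (star j) k.
    rewrite dS_chi; congr (_ * _); apply/eqP; apply: contra_notT chi_eq => neq.
    by exists k.
  by rewrite dS_chi mulrA divfK ?ddim_neq0.
under eq_bigr do rewrite !dS_chi rmorphM mulrACA.
by rewrite -mulr_sumr (dchi_orthogonal chi_neq) mulr0.
Qed.

Definition global_dim : F := \sum_k d k ^+ 2.

Lemma global_dim_gt0 : 0 < global_dim.
Proof.
rewrite /global_dim (bigD1 ord0) //= ddim1 expr1n ltr_pwDl ?ltr01 // sumr_ge0 // => k _.
by rewrite exprn_ge0 // ltW ?ddim_gt0.
Qed.

(** S times its conjugate T is a diagonal matrix, and so is T times S, with the
   same real entries.  Hence this diagonal matrix commutes with S, whose row 0
   has no zero entry: it is scalar. *)
Lemma dS_norm i : \sum_k s i k * (s i k)^* = global_dim.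
Proof.
pose nr i := \sum_k s i k * (s i k)^*.
have nr_real k : (nr k)^* = nr k.
  rewrite rmorph_sum /=; apply: eq_bigr => l _.
  by rewrite rmorphM /= conjCK mulrC.
rewrite -/(nr i); suff -> : nr i = nr ord0.
  by rewrite /nr /global_dim; apply: eq_bigr => k _; rewrite dS0 ddim_real expr2.
pose S : 'M[F]_n.+1 := \matrix_(i, j) s i j.
pose T : 'M[F]_n.+1 := \matrix_(i, j) (s i j)^*.
have ST : S *m T = diag_mx (\row_i nr i).
  apply/matrixP => k l; rewrite !mxE.
  transitivity (\sum_m s k m * (s l m)^*).
    by apply: eq_bigr => m _; rewrite !mxE (dSC m l).
  by have [->|kl] := eqVneq k l; rewrite ?mulr1n // mulr0n dS_orthogonal.
have TS : T *m S = diag_mx (\row_i nr i).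
  apply/matrixP => k l; have /matrixP/(_ k l)/(congr1 Num.conj) := ST.
  rewrite !mxE rmorph_sum /= rmorphMn /= nr_real => <-.
  by apply: eq_bigr => m _; rewrite !mxE [RHS]rmorphM /= conjCK.
have /matrixP/(_ ord0 i) : S *m (T *m S) = (S *m T) *m S by rewrite mulmxA.
rewrite TS ST mul_diag_mx mul_mx_diag !mxE mulrC.
by move/(mulIf _) => ->; rewrite ?dS0 ?ddim_neq0.
Qed.

Lemma dS_sum i j : \sum_k s i k * s j k = global_dim *+ (j == star i).
Proof.
under eq_bigr do rewrite -[s j _]conjCK -dS_starl.
have [->|ji] := eqVneq; first by rewrite dstarK dS_norm.
by rewrite dS_orthogonal // eq_sym (can2_eq (@dstarK _ _ M) (@dstarK _ _ M)).
Qed.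

(** An identity in the Grothendieck ring can be checked on the characters. *)
Lemma dS_lin_inj (c : 'I_n.+1 -> F) :
  (forall i, \sum_k c k * s i k = 0) -> forall k, c k = 0.
Proof.
move=> c0 k; have D0 : global_dim != 0 by rewrite gt_eqF ?global_dim_gt0.
apply: (mulIf D0); rewrite mul0r.
transitivity (\sum_l c l * (global_dim *+ (k == l))).
  rewrite (bigD1 k) //= eqxx big1 ?addr0 // => l lk.
  by rewrite eq_sym (negPf lk) mulr0.
transitivity (\sum_l c l * \sum_i s (star l) i * s k i).
  by apply: eq_bigr => l _; rewrite dS_sum dstarK.
under eq_bigr do rewrite mulr_sumr.
rewrite exchange_big big1 //= => i _.
transitivity (s k i * \sum_l c l * s (star i) l); last by rewrite c0 mulr0.
rewrite mulr_sumr; apply: eq_bigr => l _.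
by rewrite dS_starl -dS_starr dSC mulrA mulrC.
Qed.

Definition gauss : F := \sum_k th k * d k ^+ 2.

Lemma gauss_row i : \sum_k th k * d k * s i k = gauss * d i / th i.
Proof.
transitivity ((th i)^-1 * \sum_l d l * th l * \sum_k (N i l k)%:R * d k).
  rewrite mulr_sumr; under [RHS]eq_bigr do rewrite !mulr_sumr.
  rewrite exchange_big /=; apply: eq_bigr => k _.
  rewrite /dS !mulr_sumr; apply: eq_bigr => l _.
  have := dtwist_neq0 M k; have := dtwist_neq0 M i.
  by move=> thi thk; field; rewrite thi thk.
rewrite /gauss mulr_suml mulr_suml !mulr_sumr; apply: eq_bigr => l _.
under eq_bigr do rewrite -dchi_unit.
rewrite -dchiM !dchi_unit.
by have thi := dtwist_neq0 M i; field.
Qed.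

Lemma gauss_inv l : gauss * \sum_i s l i * d i / th i = global_dim * th l * d l.
Proof.
rewrite mulr_sumr.
transitivity (\sum_i s l i * \sum_k th k * d k * s i k).
  by apply: eq_bigr => i _; rewrite gauss_row !mulrA [s l i * _]mulrC !mulrA.
under eq_bigr do rewrite mulr_sumr.
rewrite exchange_big /= (bigD1 (star l)) //= [X in _ + X]big1 ?addr0 => [|k kl].
  transitivity (th l * d l * \sum_i s l i * s (star l) i); last first.
    by rewrite dS_sum eqxx mulr1n mulrC mulrA.
  rewrite mulr_sumr; apply: eq_bigr => i _.
  by rewrite dtwist_star ddim_star (dSC i); ring.
transitivity (th k * d k * \sum_i s l i * s k i); last first.
  by rewrite dS_sum (negPf kl) mulr0.
by rewrite mulr_sumr; apply: eq_bigr => i _; rewrite (dSC i); ring.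
Qed.

(** The relation (S T)^3 = p S^2 of the modular group, in the form in which it
   expresses S T^-1 S through T S T. *)
Lemma modular_relation i j :
  gauss * \sum_m s i m * s j m / th m = global_dim * th i * th j * (s i j)^*.
Proof.
transitivity (\sum_k (N i j k)%:R * (gauss * \sum_m s k m * d m / th m)).
  transitivity (gauss * \sum_m \sum_k (N i j k)%:R * (s k m * d m / th m)).
    congr (_ * _); apply: eq_bigr => m _.
    rewrite !(dSC _ m) dSM mulr_sumr mulr_suml.
    by apply: eq_bigr => k _; rewrite (dSC k); ring.
  rewrite exchange_big mulr_sumr; apply: eq_bigr => k _ /=.
  by rewrite -mulr_sumr mulrCA.
under eq_bigr do rewrite gauss_inv.
transitivity (global_dim * \sum_k (N i j k)%:R * d k * th k).
  by rewrite mulr_sumr; apply: eq_bigr => k _; ring.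
by rewrite dbalancing -dS_starl dS_chi dstarK ddim_star; ring.
Qed.

Lemma gauss_neq0 : gauss != 0.
Proof.
apply/eqP => g0; have := modular_relation ord0 ord0.
rewrite g0 mul0r dS0 ddim1 rmorph1 dtwist_unit !mulr1 => /esym/eqP.
by rewrite gt_eqF ?global_dim_gt0.
Qed.

End ModularDatum.

(** * The Diophantine system *)

(** The unknowns n, q, u, v, c, t, w are N_11^1, N_11^2, N_12^2, N_22^2, N_11^3,
   N_12^3, N_22^3, while a, b, f, e are the coefficients of X_1, ..., X_4 in
   X_3 X_3, and a', b' those of X_1, X_2 in X_3 X_4; h1 and h2 are the signs of
   S, and r is the trace of psi_3(3). *)

Section Arith.
Implicit Types r : int.

Lemma small_r r : r ^+ 2 * (r ^+ 2 + 3) <= 18 -> [\/ r = -1, r = 0 | r = 1].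
Proof.
move=> le18; have : r ^+ 2 <= 3 by nia.
move=> le3; have : -2 < r < 2 by nia.
move=> r2; have [->|[->|->]] : r = -1 \/ r = 0 \/ r = 1 by lia.
all: by [constructor 1|constructor 2|constructor 3].
Qed.

(** The linear equations leave a and e free.  The quadratic one is, for given r, a
   conic; for r = 1 and r = -1 it gives a product of two linear forms the value 7,
   and for r = 0 the equation for r^2 + 3 fails modulo 2. *)
Lemma arith_pos r (n q u v c t w a b e a' b' f : int) :
  0 <= n -> 0 <= q -> 0 <= u -> 0 <= v -> 0 <= c -> 0 <= t -> 0 <= w ->
  0 <= a -> 0 <= b -> 0 <= e -> 0 <= b' -> 0 <= f ->
  a' = a + 1 -> b' = b - 1 -> f = e + r ->
  n - q + c * r = 0 -> -1 = q - u + t * r -> u - v + w * r = 0 ->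
  c - t + a * r = 0 -> t - w + b * r = 0 ->
  r ^+ 2 + 3 = 2 * (3 + a - b + f * r) ->
  n + u + 2 * a' = (r ^+ 2 + 6) * a' - (r ^+ 2 + 1) ->
  q + v + 2 * b' = (r ^+ 2 + 6) * b' + (r ^+ 2 + 1) ->
  1 + n * a' + q * b' + 2 * c * f = c ^+ 2 + t ^+ 2 + a' ^+ 2 + a ^+ 2 ->
  r ^+ 2 * (r ^+ 2 + 3) <= 18 ->
  [/\ a = 0, b = 1, e = 1, f = 0 & r = -1] /\
  [/\ n = 2, q = 1, u = 1, v = 1 & [/\ c = 1, t = 1 & w = 0]].
Proof.
move=> n0 q0 u0 v0 c0 t0 w0 a0 b0 e0 b'0 f0 a'E b'E fE P11 P12 P22 P13 P23 P34 T1 T2 A11.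
subst a' b' f.
move/small_r=> [] rE; subst r; last 2 first.
- lia.
- exfalso.
  have tF : t = 2 * e + 1 by lia.
  have cF : c = 2 * e + 1 - a by lia.
  have bE : b = a + e + 2 by lia.
  have nE : n = 1 + 2 * a - c by lia.
  have qE : q = 1 + 2 * a by lia.
  subst t c b n q.
  (* With F = 2e+1, A = 2a+1 and k = F-A the conic is F(3k-1) = k^2-k+1;
     9(k^2-k+1) = (3k-1)(3k-2) + 7 turns it into a factorization of 7. *)
  have fact : (3 * (2 * e - 2 * a) - 1) * (6 * (2 * e + 1) + 3 * (2 * a + 1) + 2) = 7.
    by nia.
  have : 3 * (2 * e - 2 * a) - 1 <= 0 \/ 1 <= 3 * (2 * e - 2 * a) - 1 by lia.
  by case=> ?; nia.
- have tF : t = 2 * e - 1 by lia.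
  have cF : c = 2 * e - 1 + a by lia.
  have bE : b = a + 2 - e by lia.
  have nE : n = 1 + 2 * a + c by lia.
  have qE : q = 1 + 2 * a by lia.
  subst t c b n q.
  (* With F = 2e-1, A = 2a+1 and k = 2F-A the conic is F(3k-2) = k^2-k+1. *)
  have fact : (3 * (2 * (2 * e - 1) - (2 * a + 1)) - 2)
      * (3 * (2 * e - 1) + 3 * (2 * a + 1) + 1) = 7 by nia.
  have e_a : e + a <= 1.
    have : 3 * (2 * (2 * e - 1) - (2 * a + 1)) - 2 <= 0
        \/ 1 <= 3 * (2 * (2 * e - 1) - (2 * a + 1)) - 2 by lia.
    by case=> ?; nia.
  have [a_0 e_1] : a = 0 /\ e = 1 by lia.
  by subst; split; [split|split; [| | | |split]]; lia.
Qed.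

(** Adding up the equations shows that h1 h2 t is minus the odd number e + f, so
   the two signs differ; exchanging X_1 and X_2 exchanges the two cases. *)
Lemma arith_table r (h1 h2 : int) (n q u v c t w a b e a' b' f : nat) :
  h1 = 1 \/ h1 = -1 -> h2 = 1 \/ h2 = -1 ->
  a'%:Z = a%:Z + h1 -> b'%:Z = b%:Z + h2 -> f%:Z = e%:Z + r ->
  h1 * n%:Z + h2 * q%:Z + c%:Z * r = 0 ->
  h1 * h2 = h1 * q%:Z + h2 * u%:Z + t%:Z * r ->
  h1 * u%:Z + h2 * v%:Z + w%:Z * r = 0 ->
  h1 * c%:Z + h2 * t%:Z + a%:Z * r = 0 ->
  h1 * t%:Z + h2 * w%:Z + b%:Z * r = 0 ->
  r ^+ 2 + 3 = 2 * (3 + h1 * a%:Z + h2 * b%:Z + f%:Z * r) ->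
  n%:Z + u%:Z + 2 * a'%:Z = (r ^+ 2 + 6) * a'%:Z - (r ^+ 2 + 1) * h1 ->
  q%:Z + v%:Z + 2 * b'%:Z = (r ^+ 2 + 6) * b'%:Z - (r ^+ 2 + 1) * h2 ->
  1 + n%:Z * a'%:Z + q%:Z * b'%:Z + 2 * c%:Z * f%:Z
    = c%:Z ^+ 2 + t%:Z ^+ 2 + a'%:Z ^+ 2 + a%:Z ^+ 2 ->
  1 + u%:Z * a'%:Z + v%:Z * b'%:Z + 2 * w%:Z * f%:Z
    = t%:Z ^+ 2 + w%:Z ^+ 2 + b'%:Z ^+ 2 + b%:Z ^+ 2 ->
  r ^+ 2 * (r ^+ 2 + 3) <= 18 ->
  [/\ [/\ a = 0, b = 1, e = 1, f = 0 & a' = 1], b' = 0,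
    [/\ n = 2, q = 1, u = 1 & v = 1] & [/\ c = 1, t = 1 & w = 0]]%N \/
  [/\ [/\ b = 0, a = 1, e = 1, f = 0 & b' = 1], a' = 0,
    [/\ v = 2, u = 1, q = 1 & n = 1] & [/\ w = 1, t = 1 & c = 0]]%N.
Proof.
move=> h1E h2E a'E b'E fE P11 P12 P22 P13 P23 P34 T1 T2 A11 A22 le18.
case: h1E h2E => -> [] -> in a'E b'E P11 P12 P22 P13 P23 P34 T1 T2 *.
- exfalso; have := small_r le18; clear le18 A11 A22.
  by case=> rE; subst r; lia.
- left; have [[? ? ? ? ?] [? ? ? ? [? ? ?]]] :
      [/\ a%:Z = 0, b%:Z = 1, e%:Z = 1, f%:Z = 0 & r = -1] /\
      [/\ n%:Z = 2, q%:Z = 1, u%:Z = 1, v%:Z = 1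
        & [/\ c%:Z = 1, t%:Z = 1 & w%:Z = 0]].
    apply: (@arith_pos r n q u v c t w a b e a' b' f) => //.
    + by rewrite -P11; ring.
    + by rewrite -[LHS]mul1r P12; ring.
    + by rewrite -P22; ring.
    + by rewrite -P13; ring.
    + by rewrite -P23; ring.
    + by rewrite P34; ring.
    + by rewrite T1; ring.
    + by rewrite T2; ring.
  clear A11 A22 le18 T1 T2 P34 P11 P12 P22 P13 P23.
  by split; [split|..|split|split]; lia.
- right; have [[? ? ? ? ?] [? ? ? ? [? ? ?]]] :
      [/\ b%:Z = 0, a%:Z = 1, e%:Z = 1, f%:Z = 0 & r = -1] /\
      [/\ v%:Z = 2, u%:Z = 1, q%:Z = 1, n%:Z = 1
        & [/\ w%:Z = 1, t%:Z = 1 & c%:Z = 0]].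
    apply: (@arith_pos r v u q n w t c b a e b' a' f) => //.
    + by rewrite -P22; ring.
    + by rewrite -[LHS]mulr1 P12; ring.
    + by rewrite -P11; ring.
    + by rewrite -P23; ring.
    + by rewrite -P13; ring.
    + by rewrite P34; ring.
    + by rewrite [v%:Z + _]addrC T2; ring.
    + by rewrite [u%:Z + _]addrC T1; ring.
    + by rewrite -addrA addrCA addrA [w%:Z ^+ 2 + _]addrC -A22; ring.
  clear A11 A22 le18 T1 T2 P34 P11 P12 P22 P13 P23.
  by split; [split|..|split|split]; lia.
- exfalso; have := small_r le18; clear le18 A11 A22.
  by case=> rE; subst r; lia.
Qed.
End Arith.

(** * A quadratic system with at most one non-constant solution *)

(** In the application H = [1 x y; x y 1; y 1 x] is the block of S on the labels
   0, 1, 2, rescaled by signs, and the relation between S and the twists becomes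
   u_i (H u)_i + r z u_i = l z.  The matrix H is circulant up to a permutation:
   in the Fourier basis of Z/3, with m and n the two nontrivial coefficients of
   u, the system is linear in 1/m and 1/n. *)

Section Hankel.
Context {F : numClosedFieldType}.
Variables (x y z r l b b' : F).
Hypothesis sum_xy : 1 + x + y + r * z = 0.
Hypothesis pair_xy : x + y + x * y + 2 * z ^+ 2 = 0.
Hypothesis norm_xy : 1 + x ^+ 2 + y ^+ 2 + 2 * z ^+ 2 = (r ^+ 2 + 6) * z ^+ 2.
Hypothesis rE : r = b + b'.
Hypothesis lE : l = b - b'.
Hypothesis bb : b ^+ 2 + b' ^+ 2 = -3.
Hypothesis z0 : z != 0.
Hypothesis r0 : r != 0.
Hypothesis k0 : r ^+ 2 + 6 != 0.

Definition hankel_system (u : F * F * F) : Prop := let: (u0, u1, u2) := u in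
  [/\ u0 * (u0 + x * u1 + y * u2) + r * z * u0 - l * z = 0,
      u1 * (x * u0 + y * u1 + u2) + r * z * u1 - l * z = 0,
      u2 * (y * u0 + u1 + x * u2) + r * z * u2 - l * z = 0 &
      u0 + u1 + u2 = - (r * b')].

Lemma cube_root_unity : exists w : F, w * w = - 1 - w.
Proof.
exists ((-1 + 'i * sqrtC 3) / 2).
have i2 : 'i * 'i = -1 :> F by rewrite -expr2 sqrCi.
have s2 : sqrtC 3 * sqrtC 3 = 3 :> F by rewrite -expr2 sqrtCK.
by field: i2 s2.
Qed.

Variable w : F.
Hypothesis wE : w * w = - 1 - w.
Let h := 1 + x * w + y * (w * w).
Let h' := 1 + x * (w * w) + y * w.
Let t := - (r * b').
Let m (u : F * F * F) := u.1.1 + w * u.1.2 + w * w * u.2.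
Let n (u : F * F * F) := u.1.1 + w * w * u.1.2 + w * u.2.

Let hh' : h * h' = (r ^+ 2 + 6) * z ^+ 2.
Proof.
rewrite -norm_xy; apply/eqP; rewrite -subr_eq0; apply/eqP.
transitivity (- (x + y + x * y + 2 * z ^+ 2)); last by rewrite pair_xy oppr0.
by rewrite /h /h'; ring: wE.
Qed.

Let t3 : t - 3 = l * b.
Proof. by rewrite -[3]opprK -bb /t rE lE; ring. Qed.

Let l2 : l ^+ 2 = - (r ^+ 2 + 6).
Proof.
apply/eqP; rewrite -subr_eq0; apply/eqP.
transitivity (2 * (b ^+ 2 + b' ^+ 2 - -3)); last by rewrite bb subrr mulr0.
by rewrite lE rE; ring.
Qed.

Lemma hankel_fourier u : hankel_system u ->
  h * n u * t + h' * m u * n u = r * z * (t - 3) * m u /\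
  h' * m u * t + h * m u * n u = r * z * (t - 3) * n u.
Proof.
case: u => [[u0 u1] u2] [e0 e1 e2 et]; rewrite /m /n /=.
have rz : r * z = - (1 + x + y) by apply/eqP; rewrite -addr_eq0 addrC sum_xy.
rewrite rz in e0 e1 e2 *.
rewrite /t -et; split; apply/eqP; rewrite -subr_eq0; apply/eqP.
  transitivity (3 * (0 + w * 0 + w * w * 0) : F); last by rewrite !mulr0 !addr0 mulr0.
  rewrite -{1}e0 -{1}e1 -{1}e2 /h /h'; ring: wE.
transitivity (3 * (0 + w * w * 0 + w * 0) : F); last by rewrite !mulr0 !addr0 mulr0.
by rewrite -{1}e0 -{1}e1 -{1}e2 /h /h'; ring: wE.
Qed.

Let h0 : h != 0.
Proof.
have := mulf_neq0 k0 (expf_neq0 2 z0); rewrite -hh' mulf_eq0 negb_or.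
by case/andP.
Qed.

Let h'0 : h' != 0.
Proof.
have := mulf_neq0 k0 (expf_neq0 2 z0); rewrite -hh' mulf_eq0 negb_or.
by case/andP.
Qed.

Hypothesis t0 : t != 0.

(** The determinant of the linear system for 1/m and 1/n. *)
Let det : h * h' * t ^+ 2 - (r * z * (t - 3)) ^+ 2 != 0.
Proof.
have -> : h * h' * t ^+ 2 - (r * z * (t - 3)) ^+ 2 = - 3 * (r ^+ 2 + 6) * (r * z) ^+ 2.
  transitivity ((r ^+ 2 + 6) * (r * z) ^+ 2 * (b ^+ 2 + b' ^+ 2)).
    rewrite hh' t3; transitivity ((r ^+ 2 + 6) * z ^+ 2 * t ^+ 2 - (r * z * b) ^+ 2 * l ^+ 2).
      by ring.
    by rewrite l2 /t; ring.
  by rewrite bb; ring.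
by rewrite !mulf_neq0 ?expf_neq0 ?oppr_eq0 ?mulf_neq0 ?pnatr_eq0.
Qed.

Definition constant_triple (u : F * F * F) := (u.1.1 == u.1.2) && (u.1.2 == u.2).

Let fourier_inj u v : u.1.1 + u.1.2 + u.2 = v.1.1 + v.1.2 + v.2 ->
  m u = m v -> n u = n v -> u = v.
Proof.
case: u v => [[u0 u1] u2] [[v0 v1] v2]; rewrite /m /n /= => es em en.
have e3 : 3 != 0 :> F by rewrite pnatr_eq0.
have E0 : 3 * (u0 - v0) = 0.
  transitivity ((u0 + u1 + u2) - (v0 + v1 + v2)
      + ((u0 + w * u1 + w * w * u2) - (v0 + w * v1 + w * w * v2))
      + ((u0 + w * w * u1 + w * u2) - (v0 + w * w * v1 + w * v2))); first by ring: wE.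
  by rewrite es em en !subrr !addr0.
have E1 : 3 * (u1 - v1) = 0.
  transitivity ((u0 + u1 + u2) - (v0 + v1 + v2)
      + w * w * ((u0 + w * u1 + w * w * u2) - (v0 + w * v1 + w * w * v2))
      + w * ((u0 + w * w * u1 + w * u2) - (v0 + w * w * v1 + w * v2))); first by ring: wE.
  by rewrite es em en !subrr !mulr0 !addr0.
move/eqP: E0; rewrite mulf_eq0 (negPf e3) subr_eq0 => /eqP e0.
move/eqP: E1; rewrite mulf_eq0 (negPf e3) subr_eq0 => /eqP e1.
by subst; move/addrI: es => ->.
Qed.

Let fourier_constant u : hankel_system u ->
  (m u == 0) || (n u == 0) -> constant_triple u.
Proof.
move=> sys; have [e1 e2] := hankel_fourier sys.
have tri : (m u = 0) -> (n u = 0) -> constant_triple u.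
  move=> mu nu; pose c := (u.1.1 + u.1.2 + u.2) / 3.
  suff -> : u = (c, c, c) by rewrite /constant_triple /= eqxx.
  have c3 : 3 != 0 :> F by rewrite pnatr_eq0.
  apply: fourier_inj; rewrite ?mu ?nu /m /n /=; first by rewrite /c; field.
    by move: c => c; ring: wE.
  by move: c => c; ring: wE.
case/orP => /eqP e; move: e1 e2; rewrite e !(mulr0, mul0r, addr0, add0r).
  move/eqP; rewrite !mulf_eq0 (negPf h0) (negPf t0) orbF => /= /eqP nu _.
  exact: tri.
move=> _ /eqP; rewrite !mulf_eq0 (negPf h'0) (negPf t0) orbF => /= /eqP mu.
exact: tri.
Qed.

Lemma hankel_unique u v : hankel_system u -> hankel_system v ->
  ~~ constant_triple u -> ~~ constant_triple v -> u = v.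
Proof.
move=> su sv cu cv.
have [mu nu] : m u != 0 /\ n u != 0.
  by apply/andP; rewrite -negb_or; apply: contra cu; exact: fourier_constant.
have [mv nv] : m v != 0 /\ n v != 0.
  by apply/andP; rewrite -negb_or; apply: contra cv; exact: fourier_constant.
have sum_uv : u.1.1 + u.1.2 + u.2 = v.1.1 + v.1.2 + v.2.
  by case: u v su sv {mu nu mv nv cu cv} => [[? ?] ?] [[? ?] ?] [_ _ _ ->] [_ _ _ ->].
have [u1 u2] := hankel_fourier su; have [v1 v2] := hankel_fourier sv.
set q := r * z * (t - 3) in u1 u2 v1 v2.
have E1 : h * t * ((m u)^-1 - (m v)^-1) = q * ((n u)^-1 - (n v)^-1).
  transitivity ((h * n u * t + h' * m u * n u) / (m u * n u)
      - (h * n v * t + h' * m v * n v) / (m v * n v)).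
    by field; rewrite mu nu mv nv.
  by rewrite u1 v1; field; rewrite mu nu mv nv.
have E2 : h' * t * ((n u)^-1 - (n v)^-1) = q * ((m u)^-1 - (m v)^-1).
  transitivity ((h' * m u * t + h * m u * n u) / (m u * n u)
      - (h' * m v * t + h * m v * n v) / (m v * n v)).
    by field; rewrite mu nu mv nv.
  by rewrite u2 v2; field; rewrite mu nu mv nv.
have Dm : (h * h' * t ^+ 2 - q ^+ 2) * ((m u)^-1 - (m v)^-1) = 0.
  transitivity (h' * t * (h * t * ((m u)^-1 - (m v)^-1))
    - q * (q * ((m u)^-1 - (m v)^-1))); first by ring.
  by rewrite E1 -E2; ring.
have Dn : (h * h' * t ^+ 2 - q ^+ 2) * ((n u)^-1 - (n v)^-1) = 0.
  transitivity (h * t * (h' * t * ((n u)^-1 - (n v)^-1))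
    - q * (q * ((n u)^-1 - (n v)^-1))); first by ring.
  by rewrite E2 -E1; ring.
apply: fourier_inj => //; apply: invr_inj.
  by move/eqP: Dm; rewrite mulf_eq0 (negPf det) subr_eq0 => /eqP.
by move/eqP: Dn; rewrite mulf_eq0 (negPf det) subr_eq0 => /eqP.
Qed.

End Hankel.

Lemma sum5 (V : nmodType) (f : 'I_5 -> V) :
  \sum_k f k = f 0 + f 1 + f 2 + f 3 + f 4.
Proof.
rewrite !big_ord_recl big_ord0 addr0 !addrA.
by congr (f _ + f _ + f _ + f _ + f _); apply: val_inj.
Qed.

Lemma sum5n (f : 'I_5 -> nat) :
  (\sum_k f k = f 0%R + f 1%R + f 2%R + f 3%R + f 4%R)%N.
Proof. exact: sum5. Qed.

Lemma all5 (P : 'I_5 -> Prop) : P 0 -> P 1 -> P 2 -> P 3 -> P 4 -> forall i, P i.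
Proof.
move=> P0 P1 P2 P3 P4 [[|[|[|[|[|//]]]]] lt5].
- by rewrite (_ : Ordinal _ = 0) //; apply: val_inj.
- by rewrite (_ : Ordinal _ = 1) //; apply: val_inj.
- by rewrite (_ : Ordinal _ = 2) //; apply: val_inj.
- by rewrite (_ : Ordinal _ = 3) //; apply: val_inj.
- by rewrite (_ : Ordinal _ = 4) //; apply: val_inj.
Qed.

Definition is_sign (R : pzRingType) (e : R) := e = 1 \/ e = -1.

Lemma sign_sqr (R : pzRingType) (e : R) : is_sign e -> e * e = 1.
Proof. by case=> ->; rewrite ?mulrNN mulr1. Qed.

Lemma sqr_sign (F : fieldType) (a b : F) :
  a ^+ 2 = b ^+ 2 -> exists2 e, is_sign e & a = e * b.
Proof.
move/eqP; rewrite eqf_sqr => /orP[] /eqP->.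
  by exists 1; [left|rewrite mul1r].
by exists (-1); [right|rewrite mulN1r].
Qed.

Lemma eq_by (T : Type) (a b a' b' : T) : a = b -> a' = a -> b' = b -> a' = b'.
Proof. by move=> -> -> ->. Qed.

(** Frobenius reciprocity makes fusion coefficients invariant under
   (i, j, k) -> (j, i, k) and (i, j, k) -> (i^*, k, j).  These two involutions
   generate a dihedral group of order 12, so an orbit is exhausted by applying
   them alternately at most six times; [close] is tried on each element. *)
Ltac fusion_walk stars close comm n :=
  first [ solve [close] |
    lazymatch n with S ?m => lazymatch comm with
      | true => rewrite [LHS]dfusion_comm; fusion_walk stars close false m
      | false => rewrite [LHS]dfusion_starl ?stars; fusion_walk stars close true m
    end end ].
Ltac fusion_orbit stars close :=
  first [fusion_walk stars close true 7%N | fusion_walk stars close false 7%N].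

(** * The S-matrix in rank five *)

Section RankFive.
Context {F : numClosedFieldType} (M : modular_datum F 4).
Hypothesis star0 : dstar M 0 = 0.
Hypothesis star1 : dstar M 1 = 1.
Hypothesis star2 : dstar M 2 = 2.
Hypothesis star3 : dstar M 3 = 4.
Hypothesis S_unit : \matrix_(i, j) dS M i j \in unitmx.
Local Notation s := (dS M).
Local Notation d := (ddim M).
Let star4 : dstar M 4 = 3. Proof. by rewrite -star3 dstarK. Qed.

Lemma dim43 : d 4 = d 3. Proof. by rewrite -star3 ddim_star. Qed.

Section Galois.
Variables (L : F -> Prop) (f : F -> F) (p : 'I_5 -> 'I_5).
Hypothesis L_s : forall i j, L (s i j).
Hypothesis LD : forall x y, L x -> L y -> L (x + y).
Hypothesis LM : forall x y, L x -> L y -> L (x * y).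
Hypothesis LV : forall x, L x -> L x^-1.
Hypothesis LN : forall x, L x -> L (- x).
Hypothesis fD : forall x y, L x -> L y -> f (x + y) = f x + f y.
Hypothesis fM : forall x y, L x -> L y -> f (x * y) = f x * f y.
Hypothesis f1 : f 1 = 1.
Hypothesis f_psi : forall i j, f (s i j / d i) = s (p i) j / d (p i).
Hypothesis p0 : p 0 = 1.
Hypothesis p1 : p 1 = 2.
Hypothesis p2 : p 2 = 0.
Hypothesis p3 : p 3 = 3.

Let Ld j : L (d j). Proof. by have := L_s 0 j; rewrite (dS0 M j). Qed.
Let L1 : L 1. Proof. by have := Ld 0; rewrite (ddim1 M). Qed.
Let Lpsi i j : L (s i j / d i). Proof. by apply: LM => //; apply: LV. Qed.

Let f_inv x : L x -> x != 0 -> f x^-1 = (f x)^-1.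
Proof.
move=> Lx x0; have fx : f x * f x^-1 = 1 by rewrite -fM ?mulfV //; exact: LV.
have fx0 : f x != 0.
  by apply: contra_eq_neq fx => ->; rewrite mul0r eq_sym oner_eq0.
by apply: (mulfI fx0); rewrite fx mulfV.
Qed.

Let f_div x y : L x -> L y -> y != 0 -> f (x / y) = f x / f y.
Proof. by move=> Lx Ly y0; rewrite fM ?f_inv //; exact: LV. Qed.

Let f_sign e : is_sign e -> L e /\ f e = e.
Proof.
case=> ->; split=> //; first exact: LN.
have f0 : f 0 = 0.
  by apply: (addrI (f 1)); rewrite -fD ?addr0 // -(subrr 1); apply: LD => //; exact: LN.
apply: (addrI (f 1)); rewrite -fD ?subrr ?f0 ?f1 ?subrr //; exact: LN.
Qed.

Let f_dim j : f (d j) = s 1 j / d 1.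
Proof. by have := f_psi 0 j; rewrite p0 (dS0 M) (ddim1 M) divr1. Qed.

Let norm i := \sum_k (s i k / d i) * (s i (dstar M k) / d i).

Let normE i : norm i = global_dim M / d i ^+ 2.
Proof.
rewrite -(dS_norm S_unit i) mulr_suml; apply: eq_bigr => k _.
by rewrite dS_starr; have := ddim_neq0 M i; move=> di; field.
Qed.

Let f_sum5 (g : 'I_5 -> F) : (forall k, L (g k)) ->
  L (\sum_k g k) /\ f (\sum_k g k) = \sum_k f (g k).
Proof.
move=> Lg; rewrite !sum5; split; first by repeat apply: LD.
by rewrite !fD //; repeat apply: LD.
Qed.

Let f_norm i : L (norm i) /\ f (norm i) = norm (p i).
Proof.
have [|Lnorm ->] := f_sum5 (g := fun k => (s i k / d i) * (s i (dstar M k) / d i)).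
  by move=> k; apply: LM; apply: Lpsi.
by split=> //; apply: eq_bigr => k _; rewrite (fM (Lpsi i k) (Lpsi i _)) !f_psi.
Qed.

(** The sum norm i = D^2 / d_i^2 is expressed through the character psi_i, so f
   permutes these numbers as it permutes the characters; compare f (d_j ^ 2)
   computed from d_j ^ 2 = norm 0 / norm j with f (d_j) = s_1j / d_1. *)
Lemma galois_square j : s 1 j ^+ 2 = d (p j) ^+ 2.
Proof.
have D0 : global_dim M != 0 by rewrite gt_eqF ?global_dim_gt0.
have [dj dpj d10] : [/\ d j != 0, d (p j) != 0 & d 1 != 0] by rewrite !ddim_neq0.
have : d j * d j * norm j = norm 0.
  by rewrite !normE (ddim1 M); field.
move/(congr1 f); rewrite !fM ?f_dim //; [|exact: LM|by case: (f_norm j)].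
case: (f_norm j) (f_norm 0) => _ -> [_ ->]; rewrite p0 !normE => e.
apply: (mulfI (x := global_dim M / (d 1 ^+ 2 * d (p j) ^+ 2))).
  by rewrite mulf_neq0 // invr_eq0 mulf_neq0 // expf_neq0.
transitivity (s 1 j / d 1 * (s 1 j / d 1) * (global_dim M / d (p j) ^+ 2)); first by field; rewrite dpj.
by rewrite e; field; rewrite dpj.
Qed.

(** Applying f repeatedly to the values in row 1 determines row 2, and coming
   back to row 0 relates the signs. *)
Lemma galois_signs : exists h1 h2, [/\ is_sign h1, is_sign h2,
  s 1 1 = h2 * d 2, s 1 2 = h1 * h2 &
  [/\ s 2 2 = h1 * d 1, s 1 3 = h1 * d 3 & s 2 3 = h2 * d 3]].
Proof.
have [d1 d2 d3] : [/\ d 1 != 0, d 2 != 0 & d 3 != 0] by rewrite !ddim_neq0.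
have := galois_square 1; rewrite p1 => /sqr_sign[e e_sign s11].
have := galois_square 2; rewrite p2 (ddim1 M) => /sqr_sign[t t_sign]; rewrite mulr1 => s12.
have := galois_square 3; rewrite p3 => /sqr_sign[u u_sign s13].
have [[Le fe] [Lt ft] [Lu fu]] := And3 (f_sign e_sign) (f_sign t_sign) (f_sign u_sign).
have e0 : e != 0 by case: e_sign => ->; rewrite ?oppr_eq0 oner_eq0.
have t0 : t != 0 by case: t_sign => ->; rewrite ?oppr_eq0 oner_eq0.
have eV : e^-1 = e by apply: (mulfI e0); rewrite mulfV // sign_sqr.
have tV : t^-1 = t by apply: (mulfI t0); rewrite mulfV // sign_sqr.
have s22 : s 2 2 = e * t * d 1.
  have := f_psi 1 2; rewrite p1 s12 f_div // ft f_dim s11.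
  move/esym/(canRL (divfK d2)) => ->; rewrite -{2}eV; field.
  by rewrite e0 d2 d1.
have s23 : s 2 3 = e * d 3.
  have := f_psi 1 3; rewrite p1 s13 f_div //; last exact: LM.
  rewrite fM // fu !f_dim s11 s13.
  move/esym/(canRL (divfK d2)) => ->; rewrite -[e in RHS]eV.
  transitivity (u * u * (d 3 / e)); first by field; rewrite e0 d2 d1.
  by rewrite sign_sqr // mul1r mulrC.
have s_u : u = e * t.
  have := f_psi 2 3; rewrite p2 (dS0 M) (ddim1 M) divr1 s23 f_div //; last exact: LM.
  rewrite fM // fe !f_dim s12 s13 => e_ut.
  have eu_t : e * u = t.
    by apply: (mulIf d3); rewrite -[in RHS]e_ut; field; rewrite t0 d1.
  by rewrite -eu_t mulrA sign_sqr // mul1r.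
have et_sign : is_sign (e * t).
  by case: e_sign t_sign => -> [] ->; rewrite ?mulrNN ?mulr1 ?mul1r; [left|right|right|left].
exists (e * t), e; split=> //; first by rewrite s12 -mulrA mulrCA sign_sqr // mulr1.
by split; rewrite // s13 s_u.
Qed.

End Galois.

(** In the coordinates x, y, z, b all of S is known: after rescaling the rows and
   columns 1 and 2 by h1 and h2 it is
   [1 x y z z; x y 1 z z; y 1 x z z; z z z bz b'z; z z z b'z bz]. *)
Variables h1 h2 : F.
Hypothesis h1_sign : is_sign h1.
Hypothesis h2_sign : is_sign h2.
Hypothesis s11 : s 1 1 = h2 * d 2.
Hypothesis s12 : s 1 2 = h1 * h2.
Hypothesis s22 : s 2 2 = h1 * d 1.
Hypothesis s13 : s 1 3 = h1 * d 3.
Hypothesis s23 : s 2 3 = h2 * d 3.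

Let z := d 3.
Let b := s 3 3 / z.
Let r := b + b^*.
Let x := h1 * d 1.
Let y := h2 * d 2.

Let z0 : z != 0. Proof. exact: ddim_neq0. Qed.
Let h1C : h1^* = h1. Proof. by case: h1_sign => ->; rewrite ?rmorphN rmorph1. Qed.
Let h2C : h2^* = h2. Proof. by case: h2_sign => ->; rewrite ?rmorphN rmorph1. Qed.
Let h11 : h1 * h1 = 1. Proof. exact: sign_sqr. Qed.
Let h22 : h2 * h2 = 1. Proof. exact: sign_sqr. Qed.
Let zC : z^* = z. Proof. exact: ddim_real. Qed.

Let s0 j : s 0 j = d j. Proof. exact: dS0. Qed.
Let s_0 j : s j 0 = d j. Proof. by rewrite dSC s0. Qed.
Let d0 : d 0 = 1. Proof. exact: ddim1. Qed.
Let d4 : d 4 = z. Proof. exact: dim43. Qed.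
Let d3 : d 3 = z. Proof. by []. Qed.
Let s33 : s 3 3 = b * z. Proof. by rewrite divfK. Qed.
Let s34 : s 3 4 = b^* * z.
Proof. by rewrite -star3 dS_starr s33 rmorphM /= zC. Qed.
Let s44 : s 4 4 = b * z.
Proof. by rewrite -{1}star3 dS_starl s34 rmorphM /= zC conjCK. Qed.
Let s14 : s 1 4 = h1 * z.
Proof. by rewrite -star3 dS_starr s13 rmorphM /= zC h1C. Qed.
Let s24 : s 2 4 = h2 * z.
Proof. by rewrite -star3 dS_starr s23 rmorphM /= zC h2C. Qed.
Let s21 : s 2 1 = h1 * h2. Proof. by rewrite dSC. Qed.
Let s31 : s 3 1 = h1 * z. Proof. by rewrite dSC. Qed.
Let s32 : s 3 2 = h2 * z. Proof. by rewrite dSC. Qed.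
Let s41 : s 4 1 = h1 * z. Proof. by rewrite dSC. Qed.
Let s42 : s 4 2 = h2 * z. Proof. by rewrite dSC. Qed.
Let s43 : s 4 3 = b^* * z. Proof. by rewrite dSC. Qed.
Let sE := (s0, s_0, s11, s12, s13, s14, s21, s22, s23, s24, s31, s32, s33, s34,
  s41, s42, s43, s44, d0, d4, d3).

Lemma row_03 : 1 + x + y + r * z = 0.
Proof.
apply: (mulIf z0); rewrite mul0r.
have := dS_sum S_unit 0 3; rewrite star0 sum5 !sE mulr0n => e.
by rewrite -[RHS]e /x /y /r; ring.
Qed.

Lemma row_01 : x + y + x * y + 2 * z ^+ 2 = 0.
Proof.
have := dS_sum S_unit 0 1; rewrite star0 sum5 !sE mulr0n => /(congr1 ( *%R h1)).
by rewrite mulr0 => e; rewrite -[RHS]e /x /y; ring: h11.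
Qed.

Lemma row_33 : b ^+ 2 + b^* ^+ 2 = -3.
Proof.
have z20 : z ^+ 2 != 0 by rewrite expf_neq0.
apply: (mulIf z20); apply/eqP; rewrite -subr_eq0; apply/eqP.
have := dS_sum S_unit 3 3; rewrite star3 sum5 !sE mulr0n => e.
by rewrite -[RHS]e; ring: h11 h22.
Qed.

Lemma row_34 : global_dim M = (r ^+ 2 + 6) * z ^+ 2.
Proof.
have := dS_sum S_unit 3 4; rewrite star3 sum5 !sE mulr1n => <-.
have -> : r ^+ 2 = 2 * (b * b^*) - 3 by rewrite -row_33 /r; ring.
by ring: h11 h22.
Qed.

Lemma rank5_norm : global_dim M = 1 + x ^+ 2 + y ^+ 2 + 2 * z ^+ 2.
Proof. by rewrite /global_dim sum5 d0 d4 d3 /x /y; ring: h11 h22. Qed.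

(** The characters psi_0, psi_1, psi_2 are real on X_3, so they kill
   X_3 X_4 - X_3 X_3.  Their common kernel is spanned by X_3 - X_4 and
   1 + h1 X_1 + h2 X_2 + r X_4; the values of psi_3 and psi_4 show that the element
   is the second one.  In particular r is an integer. *)
Definition diff_coef (k : 'I_5) : F := [:: 1; h1; h2; 0; r]`_k.

Lemma fusion_34_33 k : (dfusion M 3 4 k)%:R = (dfusion M 3 3 k)%:R + diff_coef k :> F.
Proof.
apply/eqP; rewrite -subr_eq0 opprD addrA; apply/eqP.
move: k; apply: (dS_lin_inj S_unit) => i.
apply: (mulfI (ddim_neq0 M i)); rewrite mulr0.
transitivity (s i 3 * s i 4 - s i 3 * s i 3 - d i * \sum_k diff_coef k * s i k).
  rewrite !(dSM M) -!mulrBr -!sumrB; congr (_ * _); apply: eq_bigr => k _; ring.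
have r03 := row_03.
have r33 : b ^+ 2 + b^* ^+ 2 + 3 = 0 by rewrite row_33 addNr.
rewrite sum5 /diff_coef /=; move: i; apply: all5; rewrite !sE.
- by transitivity (- (1 + x + y + r * z)); [rewrite /x /y; ring | rewrite r03 oppr0].
- transitivity (- d 1 * h1 * (1 + x + y + r * z)); last by rewrite r03 mulr0.
  by rewrite /x /y; ring: h11 h22.
- transitivity (- d 2 * h2 * (1 + x + y + r * z)); last by rewrite r03 mulr0.
  by rewrite /x /y; ring: h11 h22.
- transitivity (- z ^+ 2 * (b ^+ 2 + b^* ^+ 2 + 3)); last by rewrite r33 mulr0.
  by rewrite /r; ring: h11 h22.
- transitivity (- z ^+ 2 * (b ^+ 2 + b^* ^+ 2 + 3)); last by rewrite r33 mulr0.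
  by rewrite /r; ring: h11 h22.
Qed.

(** The coefficients of the Casimir element, the sum of the X_j X_j^*, are the
   traces of the fusion matrices; psi_i takes the value D^2 / d_i^2 on it. *)
Definition casimir_coef (k : 'I_5) : F := [:: 1; h1; h2; r / 2; r / 2]`_k.

Lemma fusion_casimir k :
  \sum_j (dfusion M j (dstar M j) k)%:R
    = (r ^+ 2 + 6) * (dfusion M 3 4 k)%:R - (r ^+ 2 + 1) * casimir_coef k :> F.
Proof.
apply/eqP; rewrite -subr_eq0; apply/eqP; move: k; apply: (dS_lin_inj S_unit) => i.
apply: (mulfI (ddim_neq0 M i)); rewrite mulr0.
transitivity (global_dim M - (r ^+ 2 + 6) * (s i 3 * s i 4)
    + (r ^+ 2 + 1) * d i * \sum_k casimir_coef k * s i k).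
  rewrite -(dS_norm S_unit i).
  transitivity (d i * \sum_k ((\sum_j (dfusion M j (dstar M j) k)%:R) * s i k)
      - (r ^+ 2 + 6) * (d i * \sum_k (dfusion M 3 4 k)%:R * s i k)
      + (r ^+ 2 + 1) * d i * \sum_k casimir_coef k * s i k).
    rewrite !mulr_sumr -!sumrB -big_split /=; apply: eq_bigr => k _; ring.
  rewrite -(dSM M); congr (_ - _ + _).
  under eq_bigr do rewrite mulr_suml.
  rewrite exchange_big mulr_sumr /=; apply: eq_bigr => j _.
  by rewrite -(dSM M) dS_starr.
have r03 := row_03.
have r33 : b ^+ 2 + b^* ^+ 2 + 3 = 0 by rewrite row_33 addNr.
rewrite sum5 row_34 /casimir_coef /=; move: i; apply: all5; rewrite !sE.
- transitivity ((r ^+ 2 + 1) * (1 + x + y + r * z)); last by rewrite r03 mulr0.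
  by rewrite /x /y; field.
- transitivity ((r ^+ 2 + 1) * d 1 * h1 * (1 + x + y + r * z)); last by rewrite r03 mulr0.
  by rewrite /x /y; field: h11 h22.
- transitivity ((r ^+ 2 + 1) * d 2 * h2 * (1 + x + y + r * z)); last by rewrite r03 mulr0.
  by rewrite /x /y; field: h11 h22.
- transitivity (z ^+ 2 * (r ^+ 2 + 6) / 2 * (b ^+ 2 + b^* ^+ 2 + 3)); last by rewrite r33 mulr0.
  by rewrite /r; field: h11 h22.
- transitivity (z ^+ 2 * (r ^+ 2 + 6) / 2 * (b ^+ 2 + b^* ^+ 2 + 3)); last by rewrite r33 mulr0.
  by rewrite /r; field: h11 h22.
Qed.

Let b' := b^*.
Let rC : r^* = r. Proof. by rewrite /r rmorphD /= conjCK addrC. Qed.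
Let xC : x^* = x. Proof. by rewrite /x rmorphM /= ddim_real h1C. Qed.
Let yC : y^* = y. Proof. by rewrite /y rmorphM /= ddim_real h2C. Qed.
Let bzC : (b * z)^* = b' * z. Proof. by rewrite rmorphM /= zC. Qed.
Let b'zC : (b' * z)^* = b * z. Proof. by rewrite rmorphM /= zC conjCK. Qed.
Let h1zC : (h1 * z)^* = h1 * z. Proof. by rewrite rmorphM /= zC h1C. Qed.
Let h2zC : (h2 * z)^* = h2 * z. Proof. by rewrite rmorphM /= zC h2C. Qed.
Let h12C : (h1 * h2)^* = h1 * h2. Proof. by rewrite rmorphM /= h1C h2C. Qed.
Let h1d1C : (h1 * d 1)^* = h1 * d 1. Proof. exact: xC. Qed.
Let h2d2C : (h2 * d 2)^* = h2 * d 2. Proof. exact: yC. Qed.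
Let dC j : (d j)^* = d j. Proof. exact: ddim_real. Qed.
Let conjE := (bzC, b'zC, h1zC, h2zC, h12C, h1d1C, h2d2C, dC).
Let rE : r = b + b'. Proof. by []. Qed.
Let xE : d 1 = h1 * x. Proof. by rewrite /x mulrA h11 mul1r. Qed.
Let yE : d 2 = h2 * y. Proof. by rewrite /y mulrA h22 mul1r. Qed.

(** Put o = theta_3, t_i = theta_i and G = (1/o, t1/o, t2/o).  The modular relation
   turns into the quadratic system [hankel_system] for G, and the entries of its
   rows 0 to 2 in column 3 say that the inverse of the complex conjugate of G
   solves the same system.  Unless G is constant, the two coincide, so that G has
   entries of modulus one; as its sum is - r b', whose squared modulus is
   r^2 (r^2 + 3) / 2, the triangle inequality bounds r.  When G is constant, the
   squared modulus is the product of the sums of G and of its inverse, that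
   is, 9. *)
Lemma twist_bound : r != 0 -> r ^+ 2 * (r ^+ 2 + 3) <= 18.
Proof.
move=> r0; set o := dtwist M 3; set t1 := dtwist M 1; set t2 := dtwist M 2.
have [o0 t10 t20] : [/\ o != 0, t1 != 0 & t2 != 0] by rewrite !dtwist_neq0.
have th4 : dtwist M 4 = o by rewrite -star3 dtwist_star.
have th0 : dtwist M 0 = 1 by exact: dtwist_unit.
pose D := global_dim M; pose g := gauss M; pose l := b - b'.
have D0 : D != 0 by rewrite gt_eqF ?global_dim_gt0.
have g0 : g != 0 by apply: gauss_neq0.
have DE : D = (r ^+ 2 + 6) * z ^+ 2 by exact: row_34.
have k0 : r ^+ 2 + 6 != 0 by apply: contraNneq D0 => k0; rewrite DE k0 mul0r.
have r03 := row_03; have r01 := row_01; have r33 := row_33; have nrm := rank5_norm.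
rewrite -/D DE in nrm.
have l2 : l ^+ 2 = - (r ^+ 2 + 6).
  apply/eqP; rewrite -subr_eq0; apply/eqP.
  transitivity (2 * (b ^+ 2 + b^* ^+ 2 - -3)); last by rewrite r33 subrr mulr0.
  by rewrite /l rE /b'; ring.
have MR i j : g * (s i 0 * s j 0 + s i 1 * s j 1 / t1 + s i 2 * s j 2 / t2
    + s i 3 * s j 3 / o + s i 4 * s j 4 / o) = D * dtwist M i * dtwist M j * (s i j)^*.
  by rewrite -modular_relation // sum5 th0 th4 divr1.
have [MR33 MR34] := (MR 3 3, MR 3 4).
have [MR03 MR13 MR23] := And3 (MR 0 3) (MR 1 3) (MR 2 3).
have [MR00 MR01 MR02] := And3 (MR 0 0) (MR 0 1) (MR 0 2).
have [MR11 MR12 MR22] := And3 (MR 1 1) (MR 1 2) (MR 2 2).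
rewrite !sE -/b' !conjE th4 -/o in MR33 MR34.
rewrite !sE -/b' !conjE th0 -/o in MR03.
rewrite !sE -/b' !conjE -/o -/t1 in MR13.
rewrite !sE -/b' !conjE -/o -/t2 in MR23.
rewrite !sE -/b' rmorph1 th0 in MR00.
rewrite !sE -/b' !conjE th0 -/t1 in MR01.
rewrite !sE -/b' !conjE th0 -/t2 in MR02.
rewrite !sE -/b' !conjE -/t1 in MR11.
rewrite !sE -/b' !conjE -/t1 -/t2 in MR12.
rewrite !sE -/b' !conjE -/t2 in MR22.
rewrite DE xE yE in MR33 MR34 MR03 MR13 MR23 MR00 MR01 MR02 MR11 MR12 MR22.
clear MR.
have A03 : g * (1 + x / t1 + y / t2 + r * z / o) = (r ^+ 2 + 6) * z ^+ 2 * o.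
  apply: (mulfI z0); apply: (eq_by MR03); last by rewrite d3; ring.
  by rewrite rE; field: h11 h22; rewrite o0 t10 t20.
have A13 : g * (x + y / t1 + 1 / t2 + r * z / o) = (r ^+ 2 + 6) * z ^+ 2 * t1 * o.
  apply: (mulfI z0); apply: (eq_by (congr1 ( *%R h1) MR13)); last by ring: h11.
  by rewrite rE; field: h11 h22; rewrite o0 t10 t20.
have A23 : g * (y + 1 / t1 + x / t2 + r * z / o) = (r ^+ 2 + 6) * z ^+ 2 * t2 * o.
  apply: (mulfI z0); apply: (eq_by (congr1 ( *%R h2) MR23)); last by ring: h22.
  by rewrite rE; field: h11 h22; rewrite o0 t10 t20.
have A00 : g * (1 + x ^+ 2 / t1 + y ^+ 2 / t2 + 2 * z ^+ 2 / o)
    = (r ^+ 2 + 6) * z ^+ 2.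
  by apply: (eq_by MR00); [field: h11 h22; rewrite o0 t10 t20 | ring].
have A01 : g * (x + x * y / t1 + y / t2 + 2 * z ^+ 2 / o)
    = (r ^+ 2 + 6) * z ^+ 2 * t1 * x.
  apply: (eq_by (congr1 ( *%R h1) MR01)); last by ring: h11.
  by field: h11 h22; rewrite o0 t10 t20.
have A02 : g * (y + x / t1 + x * y / t2 + 2 * z ^+ 2 / o)
    = (r ^+ 2 + 6) * z ^+ 2 * t2 * y.
  apply: (eq_by (congr1 ( *%R h2) MR02)); last by ring: h22.
  by field: h11 h22; rewrite o0 t10 t20.
have A11 : g * (x ^+ 2 + y ^+ 2 / t1 + 1 / t2 + 2 * z ^+ 2 / o)
    = (r ^+ 2 + 6) * z ^+ 2 * t1 ^+ 2 * y.
  by apply: (eq_by MR11); [field: h11 h22; rewrite o0 t10 t20 | ring: h22].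
have A12 : g * (x * y + y / t1 + x / t2 + 2 * z ^+ 2 / o)
    = (r ^+ 2 + 6) * z ^+ 2 * t1 * t2.
  apply: (eq_by (congr1 ( *%R (h1 * h2)) MR12)); last by ring: h11 h22.
  by field: h11 h22; rewrite o0 t10 t20.
have A22 : g * (y ^+ 2 + 1 / t1 + x ^+ 2 / t2 + 2 * z ^+ 2 / o)
    = (r ^+ 2 + 6) * z ^+ 2 * t2 ^+ 2 * x.
  by apply: (eq_by MR22); [field: h11 h22; rewrite o0 t10 t20 | ring: h11].
(* The difference of the relations (3, 4) and (3, 3), where psi_3 and psi_4
   differ by l; their sum gives sumV below. *)
have gE : g = l * z * o ^+ 3.
  apply: (mulfI (mulf_neq0 k0 (expf_neq0 2 z0))).
  apply: (eq_by (congr1 ( *%R o) (congr2 (fun u v => u - v) MR34 MR33))).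
    have -> : r ^+ 2 + 6 = r ^+ 2 - 2 * (b ^+ 2 + b' ^+ 2) by rewrite r33; ring.
    by rewrite rE; field; rewrite o0 t10 t20.
  by rewrite /l; ring.
have kE : r ^+ 2 + 6 = - l ^+ 2 by rewrite l2 opprK.
have l0 : l != 0 by apply: contraNneq g0 => l_0; rewrite gE l_0 !mul0r.
have sum1 : 1 + x + y = - (r * z) by apply/eqP; rewrite -addr_eq0 r03.
have sumV : o * (1 + 1 / t1 + 1 / t2) = - (r * b).
  have nz : 2 * (l * z ^+ 3 * o ^+ 2) != 0.
    by rewrite !mulf_neq0 ?expf_neq0 ?pnatr_eq0.
  apply: (mulfI nz).
  apply: (eq_by (congr1 (fun v => v - l * z ^+ 3 * o ^+ 2 * r ^+ 2)
    (congr2 (fun u v => u + v) MR34 MR33))).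
    by rewrite gE rE; field: h11 h22; rewrite o0 t10 t20.
  by rewrite kE /l rE; ring.
have nz : l * z * o ^+ 2 != 0 by rewrite !mulf_neq0 ?expf_neq0.
(* Row i of the block against column 3, i.e. H applied to the inverse of G. *)
have Ea0 : o + x * (o / t1) + y * (o / t2) = - (z * (l / o + r)).
  apply: (mulfI nz); apply: (eq_by (congr1 (fun v => v - l * z * o ^+ 2 * (r * z)) A03)).
    by rewrite gE; field; rewrite o0 t10 t20.
  by rewrite kE; field.
have Ea1 : x * o + y * (o / t1) + o / t2 = - (z * (l * (t1 / o) + r)).
  apply: (mulfI nz); apply: (eq_by (congr1 (fun v => v - l * z * o ^+ 2 * (r * z)) A13)).
    by rewrite gE; field; rewrite o0 t10 t20.
  by rewrite kE; field.
have Ea2 : y * o + o / t1 + x * (o / t2) = - (z * (l * (t2 / o) + r)).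
  apply: (mulfI nz); apply: (eq_by (congr1 (fun v => v - l * z * o ^+ 2 * (r * z)) A23)).
    by rewrite gE; field; rewrite o0 t10 t20.
  by rewrite kE; field.
have kz0 : (r ^+ 2 + 6) * z ^+ 2 != 0 by rewrite mulf_neq0 ?expf_neq0.
(* Sum of the relations (i, 0), (i, 1), (i, 2): H applied to G. *)
have B0 : 1 + x * t1 + y * t2 = - (r * z * o) + l * z * o ^+ 2.
  apply: (mulfI kz0).
  apply: (eq_by (esym (congr2 (fun u v => u + v)
    (congr2 (fun u v => u + v) A00 A01) A02))); first by ring.
  transitivity ((1 + x + y) * (g * (1 + x / t1 + y / t2 + r * z / o))
    + g / o * z * (6 * z - (1 + x + y) * r)); last by field; rewrite o0 t10 t20.
  by rewrite A03 sum1 gE; field.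
have B1 : x + y * t1 + t2 = - (r * z * o) + l * z * o ^+ 2 / t1.
  apply: (mulfI (mulf_neq0 kz0 t10)).
  apply: (eq_by (esym (congr2 (fun u v => u + v)
    (congr2 (fun u v => u + v) A01 A11) A12))); first by ring.
  transitivity ((1 + x + y) * (g * (x + y / t1 + 1 / t2 + r * z / o))
    + g / o * z * (6 * z - (1 + x + y) * r)); last by field; rewrite o0 t10 t20.
  by rewrite A13 sum1 gE; field; rewrite t10 o0.
have B2 : y + t1 + x * t2 = - (r * z * o) + l * z * o ^+ 2 / t2.
  apply: (mulfI (mulf_neq0 kz0 t20)).
  apply: (eq_by (esym (congr2 (fun u v => u + v)
    (congr2 (fun u v => u + v) A02 A12) A22))); first by ring.
  transitivity ((1 + x + y) * (g * (y + 1 / t1 + x / t2 + r * z / o))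
    + g / o * z * (6 * z - (1 + x + y) * r)); last by field; rewrite o0 t10 t20.
  by rewrite A23 sum1 gE; field; rewrite t20 o0.
have sumG : 1 + t1 + t2 = - (r * b') * o.
  have rz0 : - (r * z) != 0 by rewrite oppr_eq0 mulf_neq0.
  apply: (mulfI rz0); rewrite -{1}sum1.
  apply: (eq_by (congr2 (fun u v => u + v) (congr2 (fun u v => u + v) B0 B1) B2)).
    by ring.
  transitivity (- (r * z * o) *+ 3 + l * z * o * (o * (1 + 1 / t1 + 1 / t2))); last first.
    by field; rewrite t10 t20.
  have three : 3 = - (b ^+ 2 + b' ^+ 2) :> F by rewrite r33 opprK.
  rewrite sumV -mulr_natr three /l rE; ring.
clear MR33 MR34 MR03 MR13 MR23 MR00 MR01 MR02 MR11 MR12 MR22.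
clear A03 A13 A23 A00 A01 A02 A11 A12 A22.
have lC : l^* = - l by rewrite /l rmorphB /= conjCK opprB.
have sumVC : o^* + (o / t1)^* + (o / t2)^* = - (r * b').
  transitivity ((o * (1 + 1 / t1 + 1 / t2))^*); last first.
    by rewrite sumV rmorphN rmorphM /= rC.
  by rewrite -!rmorphD; congr (_^*); field; rewrite t10 t20.
pose G := (o^-1, t1 / o, t2 / o); pose f := (o^*, (o / t1)^*, (o / t2)^*).
have sysG : hankel_system x y z r l b' G.
  split.
  - transitivity ((1 + x * t1 + y * t2 + r * z * o - l * z * o ^+ 2) / o ^+ 2); first by field.
    by rewrite B0; field.
  - transitivity (t1 * (x + y * t1 + t2 + r * z * o - l * z * o ^+ 2 / t1) / o ^+ 2).
      by field; rewrite t10 o0.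
    by rewrite B1; field; rewrite t10 o0.
  - transitivity (t2 * (y + t1 + x * t2 + r * z * o - l * z * o ^+ 2 / t2) / o ^+ 2).
      by field; rewrite t20 o0.
    by rewrite B2; field; rewrite t20 o0.
  - by transitivity ((1 + t1 + t2) / o); [field | rewrite sumG mulfK].
have Ea_conj u : (- (z * (l * u + r)))^* = - (z * (- l * u^* + r)).
  by rewrite rmorphN rmorphM rmorphD rmorphM /= zC lC rC.
have conjx u : (x * u)^* = x * u^* by rewrite rmorphM /= xC.
have conjy u : (y * u)^* = y * u^* by rewrite rmorphM /= yC.
have oC0 : o^* != 0 by rewrite conjC_eq0.
have t1C0 : t1^* != 0 by rewrite conjC_eq0.
have t2C0 : t2^* != 0 by rewrite conjC_eq0.
have sysf : hankel_system x y z r l b' f.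
  have := congr1 Num.conj Ea0; have := congr1 Num.conj Ea1; have := congr1 Num.conj Ea2.
  rewrite !Ea_conj !rmorphD /= !conjx !conjy => Ec2 Ec1 Ec0.
  split=> //; rewrite ?Ec0 ?Ec1 ?Ec2.
  - by rewrite fmorphV /=; field.
  - by rewrite !fmorph_div /=; field; rewrite t1C0 oC0.
  - by rewrite !fmorph_div /=; field; rewrite t2C0 oC0.
have bbE : 2 * (b * b') = r ^+ 2 + 3.
  have three : 3 = - (b ^+ 2 + b' ^+ 2) :> F by rewrite r33 opprK.
  by rewrite three rE; ring.
suff le9 : (r * b) * (r * b') <= 9.
  rewrite -bbE; apply: le_trans (_ : 2 * 9 <= _); last by rewrite -natrM.
  by rewrite (_ : r ^+ 2 * _ = 2 * ((r * b) * (r * b'))) ?ler_pM2l ?ltr0n //; ring.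
have [cG|ncG] := boolP (constant_triple G).
  have [t1_1 t2_1] : t1 = 1 /\ t2 = 1.
    case/andP: cG => /= /eqP e1 /eqP e2.
    have t1_1 : t1 = 1 by apply: (mulIf (invr_neq0 o0)); rewrite -e1 mul1r.
    by split=> //; apply: (mulIf (invr_neq0 o0)); rewrite -e2 t1_1.
  rewrite -[r * b]opprK -sumV -[r * b']opprK.
  have -> : - (r * b') = (1 + t1 + t2) / o by rewrite sumG mulfK.
  by rewrite t1_1 t2_1 (_ : _ * _ = 9) //; field.
have ncf : ~~ constant_triple f.
  apply: contra ncG => /andP[/= /eqP/(can_inj conjCK) e1 /eqP/(can_inj conjCK) e2].
  have t1_1 : t1 = 1 by apply: invr_inj; rewrite invr1; apply: (mulfI o0); rewrite -e1 mulr1.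
  have t2_1 : t2 = 1 by apply: invr_inj; rewrite invr1; apply: (mulfI o0); rewrite -e2 t1_1 divr1 mulr1.
  by rewrite /constant_triple /= t1_1 t2_1 mul1r !eqxx.
have [w wE] := @cube_root_unity F.
have b'0 : b' != 0.
  apply/eqP => b'0; have := bbE; rewrite b'0 mulr0 mulr0 => /esym/eqP.
  have r2 : 0 <= r ^+ 2 by rewrite -realEsqr; apply/CrealP.
  by rewrite gt_eqF // ltr_wpDl // ltr0n.
have t0 : - (r * b') != 0 by rewrite oppr_eq0 mulf_neq0.
have Gf : G = f.
  apply: (hankel_unique (w := w) r03 r01 _ rE (erefl l) _ z0 r0 k0 wE t0 sysG sysf ncG ncf).
    by rewrite -nrm.
  exact: r33.
case: Gf => G0 G1 G2.
have nG0 : `|o^-1| = 1.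
  apply/eqP; rewrite -(@eqrXn2 _ 2) ?ler01 // expr1n normCK {1}G0 -rmorphM /=.
  by rewrite mulfV // rmorph1.
have nG1 : `|t1 / o| = 1.
  apply/eqP; rewrite -(@eqrXn2 _ 2) ?ler01 // expr1n normCK {1}G1 -rmorphM /=.
  by rewrite (_ : _ * _ = 1) ?rmorph1 //; field; rewrite t10 o0.
have nG2 : `|t2 / o| = 1.
  apply/eqP; rewrite -(@eqrXn2 _ 2) ?ler01 // expr1n normCK {1}G2 -rmorphM /=.
  by rewrite (_ : _ * _ = 1) ?rmorph1 //; field; rewrite t20 o0.
have sG : o^-1 + t1 / o + t2 / o = - (r * b') by case: sysG.
have le3 : `|r * b'| <= 3.
  rewrite -normrN -sG; apply: le_trans (ler_normD _ _) _.
  rewrite nG2 (_ : 3 = 2 + 1 :> F); last by ring.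
  rewrite lerD2r; apply: le_trans (ler_normD _ _) _; rewrite nG0 nG1.
  by rewrite (_ : 1 + 1 = 2 :> F) //.
have -> : r * b = (r * b')^* by rewrite rmorphM /= rC /b' conjCK.
rewrite mulrC -normCK (_ : 9 = 3 ^+ 2 :> F); last by ring.
by rewrite ler_sqr ?nnegrE ?ler0n.
Qed.

Local Notation N := (dfusion M).

Let starE := (star0, star1, star2, star3, star4).

Lemma fusion_row3 j k : s 3 j * s 3 k
  = z * ((N j k 0)%:R * z + (N j k 1)%:R * (h1 * z) + (N j k 2)%:R * (h2 * z)
         + (N j k 3)%:R * (b * z) + (N j k 4)%:R * (b' * z)).
Proof. by rewrite dSM sum5 !sE. Qed.

Lemma N_to_unit j k : N j k 0 = (dstar M j == k).
Proof. by rewrite dfusion_starl dfusion_comm dfusion_unit. Qed.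

(** The equations of [arith_table] are [fusion_34_33], the multiplicativity of psi_3
   ([fusion_row3]), the traces of N_1 and N_2 ([fusion_casimir]) and the
   associativity of X_1 X_1 X_3 and X_2 X_2 X_3. *)
Lemma rank5_fusion_int (e1 e2 : int) : h1 = e1%:~R -> h2 = e2%:~R ->
  [/\ [/\ N 3 3 1 = 0%N, N 3 3 2 = 1%N, N 3 3 4 = 1%N, N 3 3 3 = 0%N & N 3 4 1 = 1%N], N 3 4 2 = 0%N,
    [/\ N 1 1 1 = 2%N, N 1 1 2 = 1%N, N 1 2 2 = 1%N & N 2 2 2 = 1%N]
    & [/\ N 1 1 3 = 1%N, N 1 2 3 = 1%N & N 2 2 3 = 0%N]] \/
  [/\ [/\ N 3 3 2 = 0%N, N 3 3 1 = 1%N, N 3 3 4 = 1%N, N 3 3 3 = 0%N & N 3 4 2 = 1%N], N 3 4 1 = 0%N,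
    [/\ N 2 2 2 = 2%N, N 1 2 2 = 1%N, N 1 1 2 = 1%N & N 1 1 1 = 1%N]
    & [/\ N 2 2 3 = 1%N, N 1 2 3 = 1%N & N 1 1 3 = 0%N]].
Proof.
move=> h1E h2E.
have N344 : N 3 4 4 = N 3 3 3.
  transitivity (N 3 4 3); first by fusion_orbit starE trivial.
  by apply: (mulrIn (oner_neq0 F)); rewrite fusion_34_33 /diff_coef /= addr0.
have [rho rhoE rhoN] : exists2 rho : int, r = rho%:~R
    & (N 3 3 3)%:Z = (N 3 3 4)%:Z + rho.
  exists ((N 3 4 4)%:Z - (N 3 3 4)%:Z); last by rewrite N344 addrC subrK.
  by rewrite rmorphB /= -!pmulrn fusion_34_33 /diff_coef /= addrAC subrr add0r.
have N114 : N 1 1 4 = N 1 1 3 by rewrite -(dfusion_dual M 1 1 3) star1 star3.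
have N124 : N 1 2 4 = N 1 2 3 by rewrite -(dfusion_dual M 1 2 3) star1 star2 star3.
have N224 : N 2 2 4 = N 2 2 3 by rewrite -(dfusion_dual M 2 2 3) star2 star3.
have N342 : (N 3 4 2)%:R = (N 3 3 2)%:R + h2 by rewrite fusion_34_33.
have N341 : (N 3 4 1)%:R = (N 3 3 1)%:R + h1 by rewrite fusion_34_33.
have [N110 N120 N220] : [/\ N 1 1 0 = 1%N, N 1 2 0 = 0%N & N 2 2 0 = 1%N].
  by rewrite !N_to_unit star1 star2.
have [N130 N230 N340] : [/\ N 1 3 0 = 0%N, N 2 3 0 = 0%N & N 3 4 0 = 1%N].
  by rewrite !N_to_unit star1 star2 star3.
have [N121 N131 N132 N133 N134] : [/\ N 1 2 1 = N 1 1 2, N 1 3 1 = N 1 1 3,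
    N 1 3 2 = N 1 2 3, N 1 3 3 = N 3 4 1 & N 1 3 4 = N 3 3 1] by split; fusion_orbit starE trivial.
have [N221 N231 N232 N233 N234] : [/\ N 2 2 1 = N 1 2 2, N 2 3 1 = N 1 2 3,
    N 2 3 2 = N 2 2 3, N 2 3 3 = N 3 4 2 & N 2 3 4 = N 3 3 2] by split; fusion_orbit starE trivial.
have [N143 N243] : N 1 4 3 = N 3 3 1 /\ N 2 4 3 = N 3 3 2 by split; fusion_orbit starE trivial.
have N343 : N 3 4 3 = N 3 3 3 by rewrite -N344; fusion_orbit starE trivial.
have z20 : z ^+ 2 != 0 by rewrite expf_neq0.
have r33 := row_33.
have bbE : r ^+ 2 + 3 = 2 * (b * b').
  have three : 3 = - (b ^+ 2 + b' ^+ 2) :> F by rewrite r33 opprK.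
  by rewrite three rE; ring.
have e1_sign : e1 = 1 \/ e1 = -1.
  by case: h1_sign => h; [left|right]; apply: (@intr_inj F); rewrite -h1E.
have e2_sign : e2 = 1 \/ e2 = -1.
  by case: h2_sign => h; [left|right]; apply: (@intr_inj F); rewrite -h2E.
have castE := (rmorphD, rmorphB, rmorphM, rmorphN, rmorphXn, rmorph1).
have := @arith_table rho e1 e2 (N 1 1 1) (N 1 1 2) (N 1 2 2) (N 2 2 2)
  (N 1 1 3) (N 1 2 3) (N 2 2 3) (N 3 3 1) (N 3 3 2) (N 3 3 4) (N 3 4 1)
  (N 3 4 2) (N 3 3 3) e1_sign e2_sign.
apply.
- by apply: (@intr_inj F); rewrite castE /= -!pmulrn -h1E.
- by apply: (@intr_inj F); rewrite castE /= -!pmulrn -h2E.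
- exact: rhoN.
- apply: (@intr_inj F); rewrite !castE /= -!pmulrn -?h1E -?h2E -?rhoE.
  have P11 := fusion_row3 1 1; rewrite !sE N110 N114 in P11.
  apply: (mulfI z20); apply: (eq_by (congr1 (fun v => v - z ^+ 2) (esym P11))).
    by rewrite rE; ring.
  by ring: h11.
- apply: (@intr_inj F); rewrite !castE /= -!pmulrn -?h1E -?h2E -?rhoE.
  have P12 := fusion_row3 1 2; rewrite !sE N120 N121 N124 in P12.
  apply: (mulfI z20); apply: (eq_by P12); first by ring.
  by rewrite rE; ring.
- apply: (@intr_inj F); rewrite !castE /= -!pmulrn -?h1E -?h2E -?rhoE.
  have P22 := fusion_row3 2 2; rewrite !sE N220 N221 N224 in P22.
  apply: (mulfI z20); apply: (eq_by (congr1 (fun v => v - z ^+ 2) (esym P22))).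
    by rewrite rE; ring.
  by ring: h22.
- apply: (@intr_inj F); rewrite !castE /= -!pmulrn -?h1E -?h2E -?rhoE.
  have P13 := fusion_row3 1 3; rewrite !sE N130 N131 N132 N133 N134 N341 in P13.
  apply: (mulfI z20).
  apply: (eq_by (congr1 (fun v => v - h1 * b * z ^+ 2) (esym P13))).
    by rewrite rE; ring.
  by ring.
- apply: (@intr_inj F); rewrite !castE /= -!pmulrn -?h1E -?h2E -?rhoE.
  have P23 := fusion_row3 2 3; rewrite !sE N230 N231 N232 N233 N234 N342 in P23.
  apply: (mulfI z20).
  apply: (eq_by (congr1 (fun v => v - h2 * b * z ^+ 2) (esym P23))).
    by rewrite rE; ring.
  by ring.
- apply: (@intr_inj F); rewrite !castE /= -!pmulrn -?h1E -?h2E -?rhoE.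
  have P34 := fusion_row3 3 4; rewrite !sE N340 N341 N342 N343 N344 in P34.
  apply: (mulfI z20); apply: (eq_by (congr1 ( *%R 2) P34)).
    by rewrite bbE; ring.
  by rewrite rE; ring: h11 h22.
- apply: (@intr_inj F); rewrite !castE /= -!pmulrn -?h1E -?h2E -?rhoE.
  have := fusion_casimir 1; rewrite sum5 star0 star1 star2 star3 star4.
  have -> : N 0 0 1 = 0%N by rewrite dfusion_unit.
  have -> : N 4 3 1 = N 3 4 1 by rewrite dfusion_comm.
  by rewrite N221 /casimir_coef /= => <-; ring.
- apply: (@intr_inj F); rewrite !castE /= -!pmulrn -?h1E -?h2E -?rhoE.
  have := fusion_casimir 2; rewrite sum5 star0 star1 star2 star3 star4.
  have -> : N 0 0 2 = 0%N by rewrite dfusion_unit.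
  have -> : N 4 3 2 = N 3 4 2 by rewrite dfusion_comm.
  by rewrite /casimir_coef /= => <-; ring.
- have := dfusion_assoc M 1 1 3 3; rewrite !sum5n N110 N130 N131 N132 N133 N134 N143.
  rewrite N114 dfusion_unit eqxx (dfusion_comm M 2 3 3) (dfusion_comm M 3 2 3).
  rewrite N233 (dfusion_comm M 4 3 3) N343.
  rewrite [nat_of_bool true]/= mul1n mul0n add0n => /(congr1 Posz).
  rewrite !(PoszD, PoszM) -[Posz 1]/(1 : int) => e.
  by apply: (eq_by e); ring.
- have := dfusion_assoc M 2 2 3 3; rewrite !sum5n N220 N221 N230 N231 N232 N233 N234 N243.
  rewrite N224 dfusion_unit eqxx N133 (dfusion_comm M 4 3 3) N343 (dfusion_comm M 2 1 3).
  rewrite [nat_of_bool true]/= mul1n mul0n add0n => /(congr1 Posz).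
  rewrite !(PoszD, PoszM) -[Posz 1]/(1 : int) => e.
  by apply: (eq_by e); ring.
- have [->|rho0] := eqVneq rho 0; first by rewrite expr0n /= mul0r.
  rewrite -(ler_int F) !castE /= -rhoE; apply: twist_bound.
  by rewrite rhoE intr_eq0.
Qed.

End RankFive.

(** * The fusion rules in rank five *)

Section Classification.
Context {F : numClosedFieldType} (M : modular_datum F 4).
Hypothesis star0 : dstar M 0 = 0.
Hypothesis star1 : dstar M 1 = 1.
Hypothesis star2 : dstar M 2 = 2.
Hypothesis star3 : dstar M 3 = 4.
Let star4 : dstar M 4 = 3. Proof. by rewrite -star3 dstarK. Qed.
Local Notation N := (dfusion M).

Let starE := (star0, star1, star2, star3, star4).

Definition swap12 : 'S_5 := tperm 1 2.

Lemma swap12E : [/\ swap12 0 = 0, swap12 1 = 2, swap12 2 = 1, swap12 3 = 3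
  & swap12 4 = 4].
Proof. by rewrite /swap12; split; rewrite permE; apply/val_inj. Qed.

Lemma fusion_table :
  [/\ [/\ N 3 3 1 = 0%N, N 3 3 2 = 1%N, N 3 3 4 = 1%N, N 3 3 3 = 0%N
      & N 3 4 1 = 1%N], N 3 4 2 = 0%N,
    [/\ N 1 1 1 = 2%N, N 1 1 2 = 1%N, N 1 2 2 = 1%N & N 2 2 2 = 1%N]
    & [/\ N 1 1 3 = 1%N, N 1 2 3 = 1%N & N 2 2 3 = 0%N]] ->
  forall i j k, N i j k = Gr_SU34Z3 i j k.
Proof.
case=> [[E1 E2 E3 E4 E5] E6 [E7 E8 E9 E10] [E11 E12 E13]].
pose facts := (E1, E2, E3, E4, E5, E6, E7, E8, E9, E10, E11, E12, E13).
apply: all5; apply: all5; apply: all5; rewrite /Gr_SU34Z3 /SU34Z3_N /= !mxE /=.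
all: fusion_orbit starE ltac:(first [by rewrite facts | by rewrite dfusion_unit]).
Qed.

Lemma fusion_table_swap :
  [/\ [/\ N 3 3 2 = 0%N, N 3 3 1 = 1%N, N 3 3 4 = 1%N, N 3 3 3 = 0%N
      & N 3 4 2 = 1%N], N 3 4 1 = 0%N,
    [/\ N 2 2 2 = 2%N, N 1 2 2 = 1%N, N 1 1 2 = 1%N & N 1 1 1 = 1%N]
    & [/\ N 2 2 3 = 1%N, N 1 2 3 = 1%N & N 1 1 3 = 0%N]] ->
  forall i j k, N i j k = Gr_SU34Z3 (swap12 i) (swap12 j) (swap12 k).
Proof.
case=> [[E1 E2 E3 E4 E5] E6 [E7 E8 E9 E10] [E11 E12 E13]].
pose facts := (E1, E2, E3, E4, E5, E6, E7, E8, E9, E10, E11, E12, E13).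
have [sw0 sw1 sw2 sw3 sw4] := swap12E.
apply: all5; apply: all5; apply: all5;
  rewrite ?(sw0, sw1, sw2, sw3, sw4) /Gr_SU34Z3 /SU34Z3_N /= !mxE /=.
all: fusion_orbit starE ltac:(first [by rewrite facts | by rewrite dfusion_unit]).
Qed.

Lemma sign_int (h : F) : is_sign h -> exists e : int, h = e%:~R.
Proof. by case=> ->; [exists 1 | exists (-1); rewrite rmorphN]. Qed.

Hypothesis S_unit : \matrix_(i, j) dS M i j \in unitmx.
Variables (L : F -> Prop) (f : F -> F) (p : 'I_5 -> 'I_5).
Hypothesis L_s : forall i j, L (dS M i j).
Hypothesis LD : forall x y, L x -> L y -> L (x + y).
Hypothesis LM : forall x y, L x -> L y -> L (x * y).
Hypothesis LV : forall x, L x -> L x^-1.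
Hypothesis LN : forall x, L x -> L (- x).
Hypothesis fD : forall x y, L x -> L y -> f (x + y) = f x + f y.
Hypothesis fM : forall x y, L x -> L y -> f (x * y) = f x * f y.
Hypothesis f1 : f 1 = 1.
Hypothesis f_psi : forall i j, f (dS M i j / ddim M i) = dS M (p i) j / ddim M (p i).
Hypothesis p_cycle : [/\ p 0 = 1, p 1 = 2, p 2 = 0 & p 3 = 3].

Theorem rank5_classification :
  (forall i j k, N i j k = Gr_SU34Z3 i j k) \/
  (forall i j k, N i j k = Gr_SU34Z3 (swap12 i) (swap12 j) (swap12 k)).
Proof.
have [p0 p1 p2 p3] := p_cycle.
have [h1 [h2 [h1_sign h2_sign s11 s12 [s22 s13 s23]]]] :=
  galois_signs S_unit L_s LD LM LV LN fD fM f1 f_psi p0 p1 p2 p3.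
have [[e1 h1E] [e2 h2E]] := (sign_int h1_sign, sign_int h2_sign).
have [/fusion_table|/fusion_table_swap] := rank5_fusion_int star0 star1 star2 star3
  S_unit h1_sign h2_sign s11 s12 s22 s13 s23 h1E h2E; by [left|right].
Qed.

End Classification.

(** * From the category to its fusion rules *)

Section BasedRing.
Variable n : nat.
Implicit Types (N : structure_constants n.+1) (x y : 'rV[int]_n.+1).

Lemma based_mulE N x y k :
  based_mul N x y 0 k = \sum_i \sum_j x 0 i * y 0 j * (N i j k)%:Z.
Proof.
rewrite /based_mul summxE; apply: eq_bigr => i _.
rewrite summxE; apply: eq_bigr => j _.
rewrite summxE (bigD1 k) //= !mxE !eqxx mulr1 big1 ?addr0 // => l lk.
by rewrite !mxE eq_sym (negPf lk) andbF mulr0.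
Qed.

Lemma based_ring_isomorphic_perm N N' (p : 'S_n.+1) : p ord0 = ord0 ->
  (forall i j k, N i j k = N' (p i) (p j) (p k)) -> based_ring_isomorphic N N'.
Proof.
move=> p0 NN'; exists (col_perm p^-1%g : {additive _ -> _}).
have elt_p i : col_perm p^-1%g (based_elt i) = based_elt (p i).
  by apply/rowP => j; rewrite !mxE eqxx /= (can2_eq (permKV p) (permK p)).
split.
- exists (col_perm p) => x; apply/rowP => j; rewrite !mxE ?permK ?permKV //.
- by rewrite /= elt_p p0.
- move=> x y; apply/rowP => k; rewrite /= based_mulE mxE based_mulE.
  rewrite [RHS](reindex_inj (@perm_inj _ p)) /=; apply: eq_bigr => i _.
  rewrite [RHS](reindex_inj (@perm_inj _ p)) /=; apply: eq_bigr => j _.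
  by rewrite !mxE !permK NN' permKV.
- apply/seteqP; split=> [_ [_ [i _ <-] <-]|_ [i _ <-]].
    by exists (p i); rewrite //= elt_p.
  by exists (based_elt (p^-1%g i)); [exists (p^-1%g i) | rewrite /= elt_p permKV].
Qed.

End BasedRing.

Section Datum.
Context {R : realType} {C : modular_category R}.
Variable (X : 'I_5 -> C).
Hypothesis X_reps : simple_representatives X.
Hypothesis X_unit : isomorphic (X 0) (unit_obj C).
Hypothesis X_dim : forall i : 'I_5, 0 < qdim (X i).
Hypothesis X_dual34 : isomorphic (X 3) (dual (X 4)).
Hypothesis X_dual1 : isomorphic (X 1) (dual (X 1)).
Hypothesis X_dual2 : isomorphic (X 2) (dual (X 2)).

Let ssC := modc_semisimple C.
Let simple1 := modc_unit C.

(** The fusion matrix of X 4 is the transpose of that of its dual X 3, so the two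
   labels may be exchanged although it is X 3 that is given as the dual of X 4. *)
Lemma dual_fusion i j k : fusion X (cycle_34 i) j k = fusion X i k j.
Proof.
have [c0 c1 c2 c3 c4] := cycle_34E.
have dual4 j' k' : fusion X 3 j' k' = fusion X 4 k' j'.
  exact: (fusion_star ssC X_reps).
move: i; apply: all5; rewrite ?(c0, c1, c2, c3, c4).
- by rewrite !(fusion_unit ssC X_reps X_unit) eq_sym.
- exact: (fusion_star ssC X_reps).
- exact: (fusion_star ssC X_reps).
- by rewrite dual4.
- exact: dual4.
Qed.

Lemma dual_theta i : theta X (cycle_34 i) = theta X i.
Proof.
have [c0 c1 c2 c3 c4] := cycle_34E.
have th34 : theta X 3 = theta X 4 by exact: (theta_dual ssC X_reps).
by move: i; apply: all5; rewrite ?(c0, c1, c2, c3, c4).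
Qed.

Definition category_datum : modular_datum R[i] 4 :=
  @ModularDatum R[i] 4 (fusion X) cycle_34 (fun i => qdim (X i)) (theta X)
    (chi ssC X_reps)
    (fusionA ssC X_reps) (fusionC X) (fusion_unit ssC X_reps X_unit)
    dual_fusion (tpermK _ _) X_dim (theta_neq0 ssC X_reps)
    (theta_unit ssC simple1 X_reps X_unit) dual_theta
    (chiM ssC X_reps) (chi_unit ssC simple1 X_reps X_unit)
    (balancing_chi ssC simple1 X_reps).

Lemma category_datumP : exists M : modular_datum R[i] 4,
  [/\ dfusion M = fusion X, dstar M = cycle_34, ddim M = (fun i => qdim (X i)) :> ('I_5 -> R[i])
    & forall i j, dS M i j = smat X i j].
Proof.
exists category_datum; split; [exact: erefl|exact: erefl|exact: erefl|move=> i j].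
rewrite /dS /smat /=; congr (_ * _); apply: eq_bigr => k _.
by rewrite (fusion_dualE ssC X_reps).
Qed.

End Datum.

Section GeneratedSubfield.
Context {F : fieldType} (S : set F).
Local Notation L := (subfield_gen S).

Lemma subfield_gen_sub x : S x -> L x.
Proof. by move=> Sx P _; apply. Qed.

Lemma subfield_gen1 : L 1.
Proof. by move=> P [P1 _ _] _. Qed.

Lemma subfield_genB x y : L x -> L y -> L (x - y).
Proof. by move=> Lx Ly P Pdiv SP; case: (Pdiv) => _ PB _; apply: PB; [apply: Lx|apply: Ly]. Qed.

Lemma subfield_gen_div x y : L x -> L y -> L (x / y).
Proof. by move=> Lx Ly P Pdiv SP; case: (Pdiv) => _ _ PV; apply: PV; [apply: Lx|apply: Ly]. Qed.

Lemma subfield_genN x : L x -> L (- x).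
Proof.
move=> Lx; rewrite -sub0r -(subrr 1); apply: subfield_genB => //.
by apply: subfield_genB; exact: subfield_gen1.
Qed.

Lemma subfield_genD x y : L x -> L y -> L (x + y).
Proof. by move=> Lx Ly; rewrite -[y]opprK; apply/subfield_genB/subfield_genN. Qed.

Lemma subfield_genV x : L x -> L x^-1.
Proof. by move=> Lx; rewrite -div1r; apply: subfield_gen_div; first exact: subfield_gen1. Qed.

Lemma subfield_genM x y : L x -> L y -> L (x * y).
Proof. by move=> Lx Ly; rewrite -[y]invrK; apply/subfield_gen_div/subfield_genV. Qed.

End GeneratedSubfield.

Theorem theorem3p7 (R : realType) (C : modular_category R) (X : 'I_5 -> C)
  (X_reps : simple_representatives X)
  (X_unit : isomorphic (X 0) (unit_obj C))
  (X_dim : forall i : 'I_5, 0 < qdim (X i))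
  (X_dual34 : isomorphic (X 3) (dual (X 4)))
  (X_dual1 : isomorphic (X 1) (dual (X 1)))
  (X_dual2 : isomorphic (X 2) (dual (X 2)))
  (X_gal : galois_perms X = <<[set cycle_012; cycle_34]>>%g) :
  based_ring_isomorphic (fusion X) Gr_SU34Z3.
Proof.
have : cycle_012 \in galois_perms X by rewrite X_gal mem_gen // !inE eqxx.
rewrite inE => /asboolP[s [[_ s1 sD sM] s_psi]].
have [M [fusM starM dimM smatE]] :=
  category_datumP X_reps X_unit X_dim X_dual34 X_dual1 X_dual2.
have [c0 c1 c2 c3 _] := cycle_34E.
have [p0 p1 p2 p3 _] := cycle_012E.
have S_unit : \matrix_(i, j) dS M i j \in unitmx.
  suff -> : \matrix_(i, j) dS M i j = Smatrix X by exact: modc_Smatrix.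
  by apply/matrixP => i j; rewrite mxE smatE [RHS]mxE.
have smat_psi i j : s (dS M i j / ddim M i) = dS M (cycle_012 i) j / ddim M (cycle_012 i).
  by rewrite !smatE dimM; exact: s_psi.
rewrite -starM in c0 c1 c2 c3; rewrite -fusM.
have [] := rank5_classification c0 c1 c2 c3 S_unit (L := smat_field X) _ _ _ _ _
  sD sM s1 smat_psi (And4 p0 p1 p2 p3).
- by move=> i j; rewrite smatE; apply: subfield_gen_sub; exists i, j.
- exact: subfield_genD.
- exact: subfield_genM.
- exact: subfield_genV.
- exact: subfield_genN.
- move=> fusE; apply: (based_ring_isomorphic_perm (p := 1%g)); first by rewrite perm1.
  by move=> i j k; rewrite !perm1; exact: fusE.
- move=> fusE; apply: (based_ring_isomorphic_perm (p := swap12)); last exact: fusE.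
  by have [] := swap12E.
Qed.
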